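(* Let $\Bbbk$ be an algebraically closed field of characteristic zero, let $\lambda\in\Bbbk$ with $\lambda\neq0$, and let $\mathfrak U=\mathfrak U(\lambda)$ be the algebra presented in the context. Let $\mathfrak U_{\mathcal S}$ be the localization of $\mathfrak U$ at the Ore set $\mathcal S=\Bbbk[g^{\pm1},x]\setminus\{0\}$, and let $\Omega=x^2g^{-1}-2\lambda(g^{-1}+g)$. Then $Z(\mathfrak U_{\mathcal S})=\Bbbk(\Omega)$ and $Z(\mathfrak U)=\Bbbk[\Omega]$.
   Context: $\mathfrak U(\lambda)$ is the associative unital $\Bbbk$-algebra generated by $g^{\pm1},x,y$ with relations $gg^{-1}=g^{-1}g=1$, $gxg^{-1}=x$, $gyg^{-1}=y+x$, $yx-xy=-\tfrac12x^2+\lambda(1-g^2)$. It is the Ore extension $\Bbbk[g^{\pm1},x][y;\delta]$, where $\delta$ is the derivation with $\delta(g)=-xg$, $\delta(x)=-\tfrac12x^2+\lambda(1-g^2)$; accordingly $\mathfrak U_{\mathcal S}=\Bbbk(g,x)[y;\delta]$. $Z(R)$ denotes the centre of a ring $R$; $\Bbbk(\Omega)$ is the field of fractions of $\Bbbk[\Omega]$. *)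

(* Defs.v *)
From HB Require Import structures.
From mathcomp Require Import all_boot all_algebra.
From mathcomp Require Import boolp classical_sets.
From mathcomp Require Import monalg.

Set Implicit Arguments.
Unset Strict Implicit.
Unset Printing Implicit Defensive.

Import GRing.Theory.

Local Open Scope classical_set_scope.
Local Open Scope ring_scope.
Local Open Scope quotient_scope.

Definition two_sided_ideal (R : nzRingType) (I : set R) : Prop :=
  [/\ I 0, forall u v, I u -> I v -> I (u - v)
    & forall a b u, I u -> I (a * u * b)].

Definition ideal_gen (R : nzRingType) (X : set R) : set R :=
  smallest (@two_sided_ideal R) X.

Definition subalg_gen (k : nzRingType) (A : algType k) (X : set A) : set A :=
  smallest [set B : set A | GRing.subalg_closed [in B]] X.

Definition ring_center (R : nzRingType) : set R :=
  [set z | forall r, GRing.comm z r].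

Definition is_inverse (R : nzRingType) (u v : R) : Prop :=
  u * v = 1 /\ v * u = 1.

(* [L] is the ring of left fractions [s^-1 u] of [A] with denominators in [S]:
   the universal [S]-inverting ring, which for a two-sided Ore set is also the
   ring of right fractions. *)
Definition ore_localization (A L : nzRingType) (S : set A)
    (iota : {rmorphism A -> L}) : Prop :=
  [/\ forall s, S s -> exists t, is_inverse (iota s) t,
      forall z, exists s u t,
        [/\ S s, is_inverse (iota s) t & z = t * iota u]
    & forall u, iota u = 0 <-> exists2 s, S s & s * u = 0].

(* The fractions [a b^-1], [a, b] in [B] and [b] nonzero, formed inside [L]; for
   a commutative domain [B] whose nonzero elements become invertible in [L],
   this is the field of fractions of [B]. *)
Definition fractions_in (A L : nzRingType) (iota : {rmorphism A -> L})
    (B : set A) : set L :=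
  [set z | exists a b t,
    [/\ B a, B b, b != 0, is_inverse (iota b) t & z = iota a * t]].

(* [ring_quotient] provides the ring structure only for commutative rings. *)
Record tsideal (R : nzRingType) := TSIdeal {
  tsideal_zmod :> zmodClosed R;
  tsidealM : forall a b u, u \in tsideal_zmod -> a * u * b \in tsideal_zmod;
  tsideal1 : 1 \notin tsideal_zmod
}.

Section TSQuotient.
Variables (k : nzRingType) (A : algType k) (I : tsideal A).

Definition tsquot : Type := {ideal_quot I}.
HB.instance Definition _ := GRing.Zmodule.copy tsquot {ideal_quot I}.
HB.instance Definition _ := EqQuotient.copy tsquot {ideal_quot I}.

Definition tspi (u : A) : tsquot := \pi_tsquot u.

Lemma tspiP (u v : A) : tspi u = tspi v <-> u - v \in tsideal_zmod I.
Proof.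
split=> [/eqP|h]; first by rewrite -(Quotient.idealrBE I).
by apply/eqP; rewrite -(Quotient.idealrBE I).
Qed.

Lemma tspi_repr (u : tsquot) : tspi (repr u) = u.
Proof. exact: reprK. Qed.

Lemma repr_tspi (u : A) : repr (tspi u) - u \in tsideal_zmod I.
Proof. by apply/tspiP; rewrite tspi_repr. Qed.

Definition tsone : tsquot := tspi 1.
Definition tsmul (u v : tsquot) : tsquot := tspi (repr u * repr v).
Definition tsscale (a : k) (u : tsquot) : tsquot := tspi (a *: repr u).

Lemma tspiD u v : tspi (u + v) = tspi u + tspi v.
Proof. exact: Quotient.pi_add. Qed.

Lemma tspi0 : tspi 0 = 0.
Proof. by apply: (addrI (tspi 0)); rewrite -tspiD !addr0. Qed.

Lemma tspiM u v : tspi (u * v) = tsmul (tspi u) (tspi v).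
Proof.
have hl w w' z : w' - w \in tsideal_zmod I -> w' * z - w * z \in tsideal_zmod I.
  by move=> hw; rewrite -mulrBl -[w' - w]mul1r tsidealM.
have hr w w' z : w' - w \in tsideal_zmod I -> z * w' - z * w \in tsideal_zmod I.
  by move=> hw; rewrite -mulrBr -[z * _]mulr1 tsidealM.
apply/esym/tspiP; rewrite -(subrKA (u * repr (tspi v))) rpredD //.
  by rewrite hl ?repr_tspi.
by rewrite hr ?repr_tspi.
Qed.

Lemma tspiZ a u : tspi (a *: u) = tsscale a (tspi u).
Proof.
apply/esym/tspiP; rewrite -scalerBr -mulr_algl -[_ * _]mulr1.
by rewrite tsidealM ?repr_tspi.
Qed.

Lemma tsmulA : associative tsmul.
Proof.
move=> u v w; rewrite -(tspi_repr u) -(tspi_repr v) -(tspi_repr w).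
by rewrite -!tspiM mulrA.
Qed.

Lemma tsmul1q : left_id tsone tsmul.
Proof. by move=> u; rewrite -(tspi_repr u) -tspiM mul1r. Qed.

Lemma tsmulq1 : right_id tsone tsmul.
Proof. by move=> u; rewrite -(tspi_repr u) -tspiM mulr1. Qed.

Lemma tsmulDl : left_distributive tsmul +%R.
Proof.
move=> u v w; rewrite -(tspi_repr u) -(tspi_repr v) -(tspi_repr w).
by rewrite -tspiD -!tspiM -tspiD mulrDl.
Qed.

Lemma tsmulDr : right_distributive tsmul +%R.
Proof.
move=> u v w; rewrite -(tspi_repr u) -(tspi_repr v) -(tspi_repr w).
by rewrite -tspiD -!tspiM -tspiD mulrDr.
Qed.

Lemma tsone_neq0 : tsone != 0.
Proof.
apply/eqP; rewrite -tspi0 => /tspiP; rewrite subr0.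
exact/negP/tsideal1.
Qed.

HB.instance Definition _ := GRing.Zmodule_isNzRing.Build tsquot
  tsmulA tsmul1q tsmulq1 tsmulDl tsmulDr tsone_neq0.

Lemma tsscaleA a b u : tsscale a (tsscale b u) = tsscale (a * b) u.
Proof. by rewrite -(tspi_repr u) -!tspiZ scalerA. Qed.

Lemma tsscale1 : left_id 1 tsscale.
Proof. by move=> u; rewrite -(tspi_repr u) -tspiZ scale1r. Qed.

Lemma tsscaleDr : right_distributive tsscale +%R.
Proof.
move=> a u v; rewrite -(tspi_repr u) -(tspi_repr v).
by rewrite -tspiD -!tspiZ -tspiD scalerDr.
Qed.

Lemma tsscaleDl u : {morph tsscale^~ u : a b / a + b}.
Proof.
by move=> a b /=; rewrite -(tspi_repr u) -!tspiZ -tspiD scalerDl.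
Qed.

HB.instance Definition _ := GRing.Zmodule_isLmodule.Build k tsquot
  tsscaleA tsscale1 tsscaleDr tsscaleDl.

Lemma tsscaleAl a (u v : tsquot) : a *: (u * v) = a *: u * v.
Proof.
rewrite -(tspi_repr u) -(tspi_repr v).
have eM x y : tspi x * tspi y = tspi (x * y) by rewrite tspiM.
have eZ x : a *: tspi x = tspi (a *: x) by rewrite tspiZ.
by rewrite !(eM, eZ) scalerAl.
Qed.

HB.instance Definition _ := GRing.Lmodule_isLalgebra.Build k tsquot tsscaleAl.

Lemma tsscaleAr a (u v : tsquot) : a *: (u * v) = u * (a *: v).
Proof.
rewrite -(tspi_repr u) -(tspi_repr v).
have eM x y : tspi x * tspi y = tspi (x * y) by rewrite tspiM.
have eZ x : a *: tspi x = tspi (a *: x) by rewrite tspiZ.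
by rewrite !(eM, eZ) scalerAr.
Qed.

HB.instance Definition _ := GRing.Lalgebra_isAlgebra.Build k tsquot tsscaleAr.

Lemma tspi_zmod_morphism : zmod_morphism tspi.
Proof.
move=> u v; apply: (addIr (tspi v)); rewrite -tspiD !subrK //.
Qed.

Lemma tspi_monoid_morphism : monoid_morphism tspi.
Proof. by split=> // u v; rewrite tspiM. Qed.

Lemma tspi_scalable : scalable tspi.
Proof. by move=> a u; rewrite tspiZ. Qed.

HB.instance Definition _ :=
  GRing.isZmodMorphism.Build A tsquot tspi tspi_zmod_morphism.
HB.instance Definition _ :=
  GRing.isMonoidMorphism.Build A tsquot tspi tspi_monoid_morphism.
HB.instance Definition _ :=
  GRing.isScalable.Build k A tsquot *:%R tspi tspi_scalable.

End TSQuotient.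

(* Each relation [l = r] is encoded as the element [l - r]. *)
Definition defining_relators (k : fieldType) (lam : k) (A : lalgType k)
    (g gi x y : A) : seq A :=
  [:: g * gi - 1;
      gi * g - 1;
      g * x * gi - x;
      g * y * gi - (y + x);
      (y * x - x * y) - (- (2^-1 *: x ^+ 2) + lam *: (1 - g ^+ 2))].

Section Presentation.
Variables (k : fieldType) (lam : k).

Lemma malg_scaleAr (K : monomType) a (u v : {malg k[K]}) :
  a *: (u * v) = u * (a *: v).
Proof.
have hc : u * a%:MP = a%:MP * u.
  rewrite !malgM_def fgmulgU fgmulUg; apply: eq_bigr => m _.
  by rewrite mulrC mulm1 mul1m.
by rewrite -[in RHS]mul_malgC mulrA hc -mulrA mul_malgC.
Qed.

(* [{fmonom I}] is the free monoid on [I], so this is the free associative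
   algebra; the variables 0, 1, 2, 3 stand for g, g^-1, x, y. *)
Definition free4 : Type := {malg k[{fmonom 'I_4}]}.
HB.instance Definition _ := GRing.Lalgebra.copy free4 {malg k[{fmonom 'I_4}]}.

Lemma free4_scaleAr a (u v : free4) : a *: (u * v) = u * (a *: v).
Proof. exact: malg_scaleAr. Qed.
HB.instance Definition _ := GRing.Lalgebra_isAlgebra.Build k free4 free4_scaleAr.

Definition var (i : 'I_4) : free4 := << fmu i >>.

Definition relators : set free4 :=
  [set` defining_relators lam (var 0) (var 1) (var 2) (var 3)].

Definition Urel : pred free4 := fun u => `[< ideal_gen relators u >].

Lemma Urel_ideal : two_sided_ideal (ideal_gen relators).
Proof.
split=> [I [[]] //|u v Iu Iv I hI|a b u Iu I hI].
  by have [[_ hB _] _] := hI; apply: hB; [exact: Iu|exact: Iv].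
by have [[_ _ hM] _] := hI; apply: hM; exact: Iu.
Qed.

Lemma UrelP u : reflect (ideal_gen relators u) (u \in Urel).
Proof. exact: asboolP. Qed.

Lemma Urel_zmod : zmod_closed Urel.
Proof.
case: Urel_ideal => h0 hB _; split=> [|u v]; first exact/UrelP.
by move=> /UrelP hu /UrelP hv; apply/UrelP; exact: hB.
Qed.
HB.instance Definition _ := GRing.isZmodClosed.Build free4 Urel Urel_zmod.

Lemma UrelM a b u : u \in Urel -> a * u * b \in Urel.
Proof. by case: Urel_ideal => _ _ hM /UrelP hu; apply/UrelP; exact: hM. Qed.

(* The ideal is proper: it is killed by the character
   g, g^-1 |-> 1 and x, y |-> 0. *)
Definition aug_mon (m : {fmonom 'I_4}) : k :=
  if all (fun i : 'I_4 => (i < 2)%N) m then 1 else 0.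

Lemma aug_mon_mult : mmorphism aug_mon.
Proof.
split=> [u v|]; last by rewrite /aug_mon fm1.
rewrite /aug_mon fmM all_cat.
by do 2!case: (all _ _); rewrite /= ?(mulr0, mulr1).
Qed.
HB.instance Definition _ :=
  monalg.isMultiplicative.Build {fmonom 'I_4} k aug_mon aug_mon_mult.

Lemma character_relators (A : lalgType k) (phi : A -> k) (g gi x y : A) :
    zmod_morphism phi -> monoid_morphism phi -> scalable_for *%R phi ->
    phi g = 1 -> phi gi = 1 -> phi x = 0 -> phi y = 0 ->
  {in defining_relators lam g gi x y, forall r, phi r = 0}.
Proof.
move=> hB [h1 hM] hZ hg hgi hx hy r.
have h0 : phi 0 = 0 by rewrite -(subrr 0) hB subrr.
have hN u : phi (- u) = - phi u by rewrite -[- u]sub0r hB h0 sub0r.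
have hD u v : phi (u + v) = phi u + phi v by rewrite -{1}[v]opprK hB hN opprK.
rewrite !inE => /orP[|/orP[|/orP[|/orP[]]]] /eqP->.
- by rewrite hB hM h1 hg hgi mulr1 subrr.
- by rewrite hB hM h1 hg hgi mulr1 subrr.
- by rewrite hB !hM hx mulr0 mul0r subrr.
- by rewrite hB !hM hD hx hy mulr0 mul0r addr0 subrr.
rewrite !(hB, hD) hN !hZ hB !expr2 !hM h1 hg hx hy.
by rewrite !(mulr0, mulr1, subrr, oppr0, addr0).
Qed.

Lemma Urel_proper : 1 \notin Urel.
Proof.
pose phi : free4 -> k := mmap idfun aug_mon.
have phiB : zmod_morphism phi by exact: raddfB.
have phiM : monoid_morphism phi by split; [exact: rmorph1|exact: rmorphM].
have phiZ : scalable_for *%R phi by move=> a u; exact: mmapZ.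
have phiv i : phi (var i) = if (i < 2)%N then 1 else 0.
  by rewrite /phi mmapU mul1r /aug_mon fmU /= andbT.
have phi0 : phi 0 = 0 by exact: raddf0.
apply/negP => /UrelP /(_ [set u | phi u = 0]) h.
suff: phi 1 = 0 by rewrite phiM.1 => /eqP; rewrite oner_eq0.
apply: h; split; last first.
  by apply: character_relators; rewrite ?phiv.
split=> [|u v|a b u] //=.
  by move=> hu hv; rewrite phiB hu hv subrr.
by move=> hu; rewrite !phiM.2 hu mulr0 mul0r.
Qed.

Definition Uideal : tsideal free4 :=
  @TSIdeal free4 (GRing.ZmodClosed.clone free4 Urel _) UrelM Urel_proper.

Definition U : Type := tsquot Uideal.

Definition Ug : U := tspi Uideal (var 0).
Definition Ugi : U := tspi Uideal (var 1).
Definition Ux : U := tspi Uideal (var 2).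
Definition Uy : U := tspi Uideal (var 3).

Definition Ucoef : set U := subalg_gen [set` [:: Ug; Ugi; Ux]].

Definition Sset : set U := Ucoef `\ 0.

Definition Omega : U := Ux ^+ 2 * Ugi - (2 * lam) *: (Ugi + Ug).

Definition kOmega : set U := subalg_gen [set Omega].

End Presentation.

Arguments ring_center R _ : clear implicits.
Arguments Ug {k} lam.
Arguments Ugi {k} lam.
Arguments Ux {k} lam.
Arguments Uy {k} lam.
Arguments Ucoef {k} lam _.
Arguments Sset {k} lam _.
Arguments Omega {k} lam.
Arguments kOmega {k} lam _.

(* Main.v *)
From HB Require Import structures.
Require Import Defs.
From mathcomp Require Import all_boot all_algebra.
From mathcomp Require Import boolp classical_sets.
From mathcomp Require Import functions finmap monalg ring zify.

Import GRing.Theory.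

Local Open Scope classical_set_scope.
Local Open Scope ring_scope.

Set Implicit Arguments.
Unset Strict Implicit.
Unset Printing Implicit Defensive.

(** Write [C] for the subalgebra generated by [g], [g^-1] and [x], and [delta] for
    the commutator with [y], a derivation of [C].

    The algebra is a free left [C]-module on the powers of [y] ([y_span],
    [y_free]). Commuting an element of degree [n > 0] in [y] with [g] lowers the
    degree and has leading coefficient [- n u_n x g], which is nonzero in
    characteristic zero; so the centralizer of [g] is [C] ([centralizer_g]), and
    central elements are the elements of [C] killed by [delta]. In the
    localization, a central fraction [s^-1 u] has [u] in [C] for the same reason,
    and [delta s * u = s * delta u] in [C].

    It remains to find the constants of [delta] in the fractions of [C]. One has
    [delta Omega = 0] and [x^2 = Omega g + 2 lam (1 + g^2)], so that elements of
    [C] are [g^-N (a + b x)] with [a], [b] in [k[Omega][g]], and [delta] acts on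
    [k[Omega][g]] as [- x g d/dg]. If [(a + b x) / s] is constant, with [s] in
    [k[Omega][g]], then [a / s] has zero derivative, so it lies in [k(Omega)]
    ([wronskian_eq0]), while [x^2 (b / s)^2] has zero derivative. Since [x^2] has
    leading coefficient [g] in [Omega], and [g] has no rational square root up to
    constants, this forces [b = 0] ([xsq_sqrt_eq0]).

    What needs a construction is the freeness: that the presentation does not
    collapse. It follows from the action of the generators on formal Laurent
    series in [g] with coefficients in [k[Omega] + k[Omega] x], extended by powers
    of [y]; the image of [1] under this action displays the coordinates of an
    element ([U_coordinates], [coords_nf], [coords_yX]). *)

(** * Representations of the presented algebra *)

Section LinearMorph.
Variables (k : pzRingType) (V W : lmodType k) (f : V -> W).
Hypothesis f_linear : linear f.

Lemma linear_morph0 : f 0 = 0.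
Proof.
by have := f_linear (-1) 0 0; rewrite scaler0 addr0 scaleN1r addNr.
Qed.

Lemma linear_morph_sum (I : Type) (r : seq I) (F : I -> V) :
  f (\sum_(i <- r) F i) = \sum_(i <- r) f (F i).
Proof.
apply: big_morph; last exact: linear_morph0.
by move=> v w; rewrite -[v]scale1r f_linear !scale1r.
Qed.

End LinearMorph.

Section FreeAction.
Variables (k : fieldType) (V : lmodType k) (op : 'I_4 -> V -> V).
Hypothesis op_linear : forall i, linear (op i).

Definition word_act (m : {fmonom 'I_4}) (v : V) : V := foldr op v m.

Definition free_act (u : free4 k) (v : V) : V :=
  \sum_(m <- msupp u) u@_m *: word_act m v.

Lemma free_actEw (d : {fset {fmonom 'I_4}}) u v :
  (msupp u `<=` d)%fset -> free_act u v = \sum_(m <- d) u@_m *: word_act m v.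
Proof.
move=> le; rewrite /free_act (big_fset_incl _ le) //= => m _ /mcoeff_outdom ->.
by rewrite scale0r.
Qed.

Lemma free_actU c m v : free_act << c *g m >> v = c *: word_act m v.
Proof. by rewrite (free_actEw _ msuppU_le) big_seq_fset1 mcoeffUU. Qed.

Lemma free_act_linearl v : linear (free_act^~ v).
Proof.
move=> a u w.
pose d := (msupp u `|` msupp w `|` msupp (a *: u + w))%fset.
have du : (msupp u `<=` d)%fset by rewrite /d -fsetUA fsubsetUl.
have dw : (msupp w `<=` d)%fset by rewrite /d fsubsetU // fsubsetUr.
rewrite !(@free_actEw d) ?fsubsetUr //.
rewrite scaler_sumr -big_split /=; apply: eq_bigr => m _.
by rewrite mcoeffD mcoeffZ scalerDl scalerA.
Qed.

Lemma word_act_linear m : linear (word_act m).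
Proof.
move=> a v w; rewrite /word_act; elim: (m : seq _) => //= i s ->.
exact: op_linear.
Qed.

Lemma free_act_linearr u : linear (free_act u).
Proof.
move=> a v w; rewrite /free_act scaler_sumr -big_split /=.
apply: eq_bigr => m _.
by rewrite word_act_linear scalerDr !scalerA mulrC.
Qed.

Lemma free_act1 v : free_act 1 v = v.
Proof. by rewrite free_actU scale1r /word_act fm1. Qed.

Lemma free_act_var i v : free_act (var k i) v = op i v.
Proof. by rewrite free_actU scale1r /word_act fmU. Qed.

Lemma free_actM u w v : free_act (u * w) v = free_act u (free_act w v).
Proof.
rewrite malgME (linear_morph_sum (free_act_linearl v)) [RHS]/free_act.
apply: eq_bigr => m _; rewrite (linear_morph_sum (free_act_linearl v)).
rewrite (linear_morph_sum (word_act_linear m)) scaler_sumr.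
apply: eq_bigr => n _; rewrite free_actU -[_ *: word_act n v]addr0.
rewrite (word_act_linear m) (linear_morph0 (word_act_linear m)) addr0 scalerA.
by congr (_ *: _); rewrite /word_act fmM foldr_cat.
Qed.

Variable lam : k.
Hypothesis op_relators : forall v,
  {in defining_relators lam (var k 0) (var k 1) (var k 2) (var k 3),
    forall r, free_act r v = 0}.

(** The elements acting by zero form a two-sided ideal, so a module over the
    free algebra on which the relators vanish is a module over the quotient. *)
Lemma free_act_Urel u v : u \in Urel lam -> free_act u v = 0.
Proof.
move=> /UrelP /(_ [set u | forall v, free_act u v = 0]); apply; split.
  split=> [w|r s hr hs w|a b r hr w] /=.
  - by rewrite /free_act msupp0 big_seq_fset0.
  - by rewrite -[r - s]addrC -scaleN1r free_act_linearl hr hs scaler0 addr0.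
  - by rewrite !free_actM hr (linear_morph0 (free_act_linearr a)).
by move=> r hr w; apply: op_relators.
Qed.

Definition U_act (u : U lam) (v : V) : V := free_act (repr u) v.

Lemma U_act_tspi u v : U_act (tspi (Uideal lam) u) v = free_act u v.
Proof.
apply/eqP; rewrite -subr_eq0 -[X in _ - X]scale1r addrC -scaleNr.
by rewrite -free_act_linearl scaleN1r addrC free_act_Urel // repr_tspi.
Qed.

Lemma U_act_linearl v : linear (U_act^~ v).
Proof.
move=> a u w; rewrite -(tspi_repr u) -(tspi_repr w).
by rewrite -linearP !U_act_tspi free_act_linearl.
Qed.

Lemma U_act1 v : U_act 1 v = v.
Proof. by rewrite U_act_tspi free_act1. Qed.

Lemma U_actM u w v : U_act (u * w) v = U_act u (U_act w v).
Proof.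
rewrite -(tspi_repr u) -(tspi_repr w) -rmorphM.
by rewrite !U_act_tspi free_actM.
Qed.

Lemma U_act_gen i v : U_act (tspi (Uideal lam) (var k i)) v = op i v.
Proof. by rewrite U_act_tspi free_act_var. Qed.

End FreeAction.

(** * A faithful module *)

Section LaurentModule.
Variables (k : fieldType) (lam : k).
Hypothesis two_neq0 : (2 : k) != 0.

(** A function [f : laurent] stands for the formal series
    [sum_j g^j ((f j).1 + (f j).2 x)] with coefficients in [k[Omega]], possibly
    infinite in both directions. Using series rather than the field of
    fractions makes [g] invertible as a mere shift of indices, and the
    derivation [g d/dg] is multiplication by the index. *)
Definition laurent : Type := int -> {poly k} * {poly k}.
HB.instance Definition _ := GRing.Lmodule.on laurent.

Definition lau_shift (d : int) (f : laurent) : laurent := fun j => f (j - d).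

(** Multiplication by [x], where [x^2 = Omega g + 2 lam (1 + g^2)]. *)
Definition lau_x (f : laurent) : laurent := fun j =>
  ('X * (f (j - 1)).2 + (2 * lam) *: ((f j).2 + (f (j - 2)).2), (f j).1).

(** The derivation [delta = [y, -]]: it kills [Omega], so it is
    [- x g d/dg], with [delta(x) = - (g/2) d(x^2)/dg]. *)
Definition lau_d (f : laurent) : laurent := fun j =>
  (- ((j%:~R - 2^-1) *: ('X * (f (j - 1)).2) + (2 * lam * j%:~R) *: (f j).2
      + (2 * lam * (j - 1)%:~R) *: (f (j - 2)).2),
   - (j%:~R *: (f j).1)).

(** [w : ore_space] stands for [sum_n w_n y^n]: the Ore extension acts by
    [y w_n y^n = w_n y^(n+1) + delta(w_n) y^n]. *)
Definition ore_space : Type := nat -> laurent.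
HB.instance Definition _ := GRing.Lmodule.on ore_space.

Definition ore_y (w : ore_space) : ore_space := fun n =>
  (if n is n'.+1 then w n' else 0) + lau_d (w n).

Definition ore_op (i : 'I_4) (w : ore_space) : ore_space :=
  match i : nat with
  | 0 => fun n => lau_shift 1 (w n)
  | 1 => fun n => lau_shift (-1) (w n)
  | 2 => fun n => lau_x (w n)
  | _ => ore_y w
  end.

Lemma lau_shift_linear d : linear (lau_shift d).
Proof. by []. Qed.

Lemma pair_eq (A B : Type) (p q : A * B) : p.1 = q.1 -> p.2 = q.2 -> p = q.
Proof. by case: p q => ? ? [? ?] /= -> ->. Qed.

Lemma lau_x_linear : linear lau_x.
Proof.
move=> a f h; apply/funext => j; apply: pair_eq => //=.
by rewrite -!mul_polyC; ring.
Qed.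

Lemma lau_d_linear : linear lau_d.
Proof.
by move=> a f h; apply/funext => j; apply: pair_eq => /=; rewrite -!mul_polyC; ring.
Qed.

Lemma lau_shiftK d : cancel (lau_shift d) (lau_shift (- d)).
Proof. by move=> f; apply/funext => j; rewrite /lau_shift opprK addrK. Qed.

Lemma lau_shift_x d f : lau_shift d (lau_x f) = lau_x (lau_shift d f).
Proof. by apply/funext => j; rewrite /lau_x /lau_shift (addrAC _ (-d)) (addrAC _ (-d)). Qed.

Lemma lau_d_shift f :
  lau_d (lau_shift 1 f) = lau_shift 1 (lau_d f) - lau_x (lau_shift 1 f).
Proof.
apply/funext => j; apply: pair_eq; rewrite /= /lau_shift ?(addrAC j (-2) (-1)).
  by rewrite -!mul_polyC !rmorphB /=; ring.
by rewrite -!mul_polyC !rmorphB /=; ring.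
Qed.

Lemma lau_d_x f : lau_d (lau_x f) - lau_x (lau_d f) =
  - (2^-1 *: lau_x (lau_x f)) + lam *: (f - lau_shift 1 (lau_shift 1 f)).
Proof.
have h2 : (2^-1 : k)%:P * 2 = 1.
  by rewrite -(rmorph_nat (@polyC k)) -polyCM mulVf.
have e2 (j : int) : j - 1 - 1 = j - 2 by ring.
(* Both identities below hold up to a multiple of [(1/2) * 2 - 1]. *)
have half_two (Z p q : {poly k}) : p - q = ((2^-1)%:P * 2 - 1) * Z -> p = q.
  by rewrite h2 subrr mul0r; apply: subr0_eq.
apply/funext => j; apply: pair_eq;
  rewrite /= /lau_shift ?e2 ?(addrAC j (-2) (-1)) -!mul_polyC !rmorphB /=.
  apply: (half_two ('X * (f (j - 1)).1 + lam%:P * ((f j).1 + (f (j - 2)).1))).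
  by move: (2^-1) => c; ring.
apply: (half_two (lam%:P * ((f j).2 + (f (j - 2)).2))).
by move: (2^-1) => c; ring.
Qed.

Lemma ore_op_linear i : linear (ore_op i).
Proof.
case: i => [] [|[|[|i]]] hi a v w; apply/funext => n; rewrite /ore_op /=.
- exact: lau_shift_linear.
- exact: lau_shift_linear.
- exact: lau_x_linear.
rewrite -[RHS]/(a *: ore_y v n + ore_y w n) /ore_y.
rewrite -[(a *: v + w) n]/(a *: v n + w n) lau_d_linear scalerDr addrACA.
by case: n => [|n]; rewrite ?scaler0 ?addr0.
Qed.

Lemma ore_relators v :
  {in defining_relators lam (var k 0) (var k 1) (var k 2) (var k 3),
    forall r, free_act ore_op r v = 0}.
Proof.
pose act := free_act ore_op.
have actD u w z : act (u + w) z = act u z + act w z.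
  by have := free_act_linearl ore_op z 1 u w; rewrite !scale1r.
have actZ a u z : act (a *: u) z = a *: act u z.
  have act0 : act 0 z = 0 := linear_morph0 (free_act_linearl ore_op z).
  by have := free_act_linearl ore_op z a u 0; rewrite -!/(act _ _) act0 !addr0.
have actN u z : act (- u) z = - act u z.
  apply/eqP; rewrite -addr_eq0 -actD addNr.
  by rewrite /act (linear_morph0 (free_act_linearl ore_op z)).
have actM u w z : act (u * w) z = act u (act w z).
  exact: free_actM ore_op_linear _ _ _.
have act1 z : act 1 z = z by exact: free_act1.
have actV i z : act (var k i) z = ore_op i z by exact: free_act_var.
move=> r; rewrite !inE -/act => hr; clearbody act; apply/funext => n.
have cancelS f : lau_shift 1 (lau_shift (-1) f) = f.
  by have := lau_shiftK (-1) f; rewrite opprK.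
have shiftD f h : lau_shift 1 (f + h) = lau_shift 1 f + lau_shift 1 h by [].
have xD f h : lau_x (f + h) = lau_x f + lau_x h.
  by have := lau_x_linear 1 f h; rewrite !scale1r.
case/or4P: hr => [|||/orP[]] /eqP->;
  rewrite ?expr2 !(actD, actN, actZ, actM, act1, actV) /ore_op /=;
  apply/eqP; rewrite subr_eq0; apply/eqP.
- exact: cancelS.
- exact: (lau_shiftK 1).
- by rewrite lau_shift_x cancelS.
- rewrite -[RHS]/(ore_y v n + lau_x (v n)) /ore_y shiftD -addrA.
  congr (_ + _); first by case: n => // n; apply: cancelS.
  by have := lau_d_shift (lau_shift (-1) (v n)); rewrite cancelS => ->; rewrite subrK.
rewrite -[RHS]/(- (2^-1 *: lau_x (lau_x (v n)))
   + lam *: (v n - lau_shift 1 (lau_shift 1 (v n)))) -lau_d_x.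
rewrite -[LHS]/(ore_y (fun n => lau_x (v n)) n - lau_x (ore_y v n)).
rewrite /ore_y xD opprD addrACA.
case: n => [|n]; last by rewrite subrr add0r.
by rewrite (linear_morph0 lau_x_linear) subrr add0r.
Qed.

End LaurentModule.

(** * Generated subalgebras *)

Section SubalgGen.
Variables (k : fieldType) (A : algType k).
Implicit Types (X B : set A).

Definition subalg B : Prop :=
  [/\ B 1, forall (a : k) u v, B u -> B v -> B (a *: u + v)
    & forall u v, B u -> B v -> B (u * v)].

Lemma subalgP B : GRing.subalg_closed [in B] <-> subalg B.
Proof.
have inB u : (u \in [in B]) = (u \in B) by [].
split=> [[h1 hL hM]|[h1 hL hM]]; split.
- exact: set_mem.
- by move=> a u v hu hv; apply: set_mem; apply: (hL a); exact: mem_set.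
- by move=> u v hu hv; apply: set_mem; apply: hM; exact: mem_set.
- exact: mem_set.
- by move=> a u v /set_mem hu /set_mem hv; apply: mem_set; exact: hL.
- by move=> u v /set_mem hu /set_mem hv; apply: mem_set; exact: hM.
Qed.

Lemma subalg_gen_min X B : subalg B -> X `<=` B -> subalg_gen X `<=` B.
Proof. by move=> /subalgP hB hX u; apply. Qed.

Lemma subalg_gen_sub X : X `<=` subalg_gen X.
Proof. by move=> u Xu B [_]; apply. Qed.

Lemma subalg_gen_subalg X : subalg (subalg_gen X).
Proof.
split=> [B [/subalgP[]] //|a u v hu hv B hB|u v hu hv B hB].
  by have [/subalgP[_ hL _] _] := hB; apply: hL; [exact: hu|exact: hv].
by have [/subalgP[_ _ hM] _] := hB; apply: hM; [exact: hu|exact: hv].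
Qed.

Lemma subalg_centralizer X : subalg [set u | forall v, X v -> GRing.comm u v].
Proof.
split=> [v _|a u w hu hw v Xv|u w hu hw v Xv] /=.
- exact/commr_sym/commr1.
- apply/commr_sym/commrD; apply/commr_sym; last exact: hw.
  by rewrite /GRing.comm -scalerAl -scalerAr hu.
- by apply/commr_sym/commrM; apply/commr_sym; [exact: hu|exact: hw].
Qed.

(** Centralizers are subalgebras; this is applied once on each side. *)
Lemma subalg_gen_comm X :
    (forall u v, X u -> X v -> GRing.comm u v) ->
  forall u v, subalg_gen X u -> subalg_gen X v -> GRing.comm u v.
Proof.
move=> hX.
have gen_comm Y : (forall u, X u -> forall v, Y v -> GRing.comm u v) ->
    forall u v, subalg_gen X u -> Y v -> GRing.comm u v.
  move=> hY u v hu; apply: (subalg_gen_min (subalg_centralizer Y) _ hu) => w Xw.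
  exact: hY.
apply: (gen_comm _) => u Xu v hv; apply: commr_sym.
by apply: (gen_comm X _ v u hv Xu) => w Xw z; exact: hX.
Qed.

Definition subalg_pred X : {pred A} := fun u => `[< subalg_gen X u >].

Lemma subalg_predP X u : reflect (subalg_gen X u) (u \in subalg_pred X).
Proof. exact: asboolP. Qed.

Lemma subalg_pred_closed X : GRing.subsemialg_closed (subalg_pred X).
Proof.
apply: GRing.subalg_closed_semi; have [h1 hL hM] := subalg_gen_subalg X.
split; first exact/subalg_predP.
  by move=> a u v /subalg_predP hu /subalg_predP hv; apply/subalg_predP; exact: hL.
by move=> u v /subalg_predP hu /subalg_predP hv; apply/subalg_predP; exact: hM.
Qed.

HB.instance Definition _ X :=
  GRing.isSubalgClosed.Build k A (subalg_pred X) (subalg_pred_closed X).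

End SubalgGen.

(** * Relations and coordinates *)

Section GeneratorRelations.
Variables (k : fieldType) (lam : k).

Definition relations (A : algType k) (g gi x y : A) : Prop :=
  [/\ g * gi = 1, gi * g = 1, g * x = x * g,
      y * g - g * y = - (x * g)
    & y * x - x * y = - (2^-1 *: x ^+ 2) + lam *: (1 - g ^+ 2)].

(** Stated for an abstract morphism so that the computation never unfolds the
    quotient construction. *)
Lemma relators_relations (A B : algType k) (f : {lrmorphism A -> B}) g gi x y :
  (forall i, f (nth 0 (defining_relators lam g gi x y) i) = 0) ->
  relations (f g) (f gi) (f x) (f y).
Proof.
move=> hf.
have := hf 0; rewrite /= rmorphB rmorphM rmorph1 => /subr0_eq ggi.
have := hf 1; rewrite /= rmorphB rmorphM rmorph1 => /subr0_eq gig.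
have := hf 2; rewrite /= rmorphB !rmorphM => /subr0_eq gx.
have := hf 3; rewrite /= rmorphB !rmorphM rmorphD => /subr0_eq gy.
have := hf 4; rewrite /= !rmorphB !rmorphM rmorphD rmorphN /= !linearZ /= rmorphB.
rewrite !rmorphXn rmorph1 => /subr0_eq yx.
split=> //; first by rewrite -[in RHS]gx -[RHS]mulrA gig mulr1.
  have : f g * f y * f gi * f g = (f y + f x) * f g by rewrite gy.
  by rewrite -(mulrA (f g * f y)) gig mulr1 mulrDl => ->; rewrite opprD addNKr.
by rewrite -scalerN.
Qed.

Lemma U_relations : relations (Ug lam) (Ugi lam) (Ux lam) (Uy lam).
Proof.
apply: (@relators_relations _ _ (tspi (Uideal lam))) => i.
set rs := defining_relators _ _ _ _ _.
have [le_i|lt_i] := leqP (size rs) i; first by rewrite nth_default ?rmorph0.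
apply: etrans (tspi0 (Uideal lam)); apply/tspiP; rewrite subr0.
by apply/UrelP => I [_ hI]; apply: hI; exact: mem_nth.
Qed.

Lemma free4_image_ind (A : algType k) (f : {lrmorphism free4 k -> A}) (B : set A) :
  subalg B -> (forall i, B (f (var k i))) -> forall u, B (f u).
Proof.
move=> [h1 hL hM] hv u.
have h0 : B 0 by rewrite -(addNr 1) -scaleN1r; apply: hL.
rewrite [u]monalgE rmorph_sum /=.
elim: (enum_fset _) => [|m s IH]; first by rewrite big_nil.
rewrite big_cons -[<< _ *g _ >>]/(<< _ *g m >> : free4 k).
have -> : << u@_m *g m >> = u@_m *: (<< m >> : free4 k).
  by rewrite -mul_malgC malgM_def fgmulUU mulr1 mul1m.
rewrite linearZ; apply: hL => //.
case: m => w; elim: w => [|i w IHw].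
  have -> : FMonom [::] = mone :> {fmonom 'I_4} by rewrite -fmE.
  by rewrite rmorph1.
have -> : << FMonom (i :: w) >> = var k i * << FMonom w >> :> free4 k.
  rewrite malgM_def fgmulUU mulr1; congr << _ >>.
  by apply: val_inj; apply: (etrans _ (esym (fmM _ _))); rewrite fmU.
by rewrite rmorphM; exact: hM (hv i) IHw.
Qed.

Lemma U_gen_ind (B : set (U lam)) :
  subalg B -> B (Ug lam) -> B (Ugi lam) -> B (Ux lam) -> B (Uy lam) ->
  forall u, B u.
Proof.
move=> hB hg hgi hx hy u; rewrite -(tspi_repr u).
apply: (free4_image_ind (f := tspi (Uideal lam)) hB) => i.
have eq_var (j : 'I_4) : i = j :> nat -> var k i = var k j by move/val_inj->.
case: i eq_var => [] [|[|[|[|//]]]] hi eq_var.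
- by rewrite (eq_var 0).
- by rewrite (eq_var 1).
- by rewrite (eq_var 2).
- by rewrite (eq_var 3).
Qed.

End GeneratorRelations.

Section Coordinates.
Variables (k : fieldType) (lam : k).
Hypothesis two_neq0 : (2 : k) != 0.

(** The element [1] of [ore_space], as the vector whose orbit map gives
    coordinates. *)
Definition ore1 : ore_space k :=
  fun n j => if (n == 0%N) && (j == 0) then (1, 0) else 0.

Lemma U_coordinates : exists coords : U lam -> ore_space k,
  [/\ linear coords /\ coords 1 = ore1,
      forall u, coords (Ug lam * u) = fun n => lau_shift 1 (coords u n),
      forall u, coords (Ugi lam * u) = fun n => lau_shift (-1) (coords u n),
      forall u, coords (Ux lam * u) = fun n => lau_x lam (coords u n)
    & forall u, coords (Uy lam * u) = ore_y lam (coords u)].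
Proof.
pose act : U lam -> ore_space k -> ore_space k := fun u v => U_act (ore_op lam) u v.
have opL := @ore_op_linear k lam.
have opR := @ore_relators k lam two_neq0.
exists (act^~ ore1); split.
- by split; [move=> a u v; exact: (U_act_linearl opL opR) | exact: (U_act1 opL opR)].
all: move=> u; rewrite /act (U_actM opL opR).
- exact: (U_act_gen opL opR 0).
- exact: (U_act_gen opL opR 1).
- exact: (U_act_gen opL opR 2).
- exact: (U_act_gen opL opR 3).
Qed.

End Coordinates.

(** * Differential equations over k[Omega][g] *)

Lemma coefM_top (R : nzRingType) (p q : {poly R}) i j :
  (size p <= i.+1)%N -> (size q <= j.+1)%N -> (p * q)`_(i + j) = p`_i * q`_j.
Proof.
move=> hp hq; rewrite coefM.
have hi : (i < (i + j).+1)%N by rewrite ltnS leq_addr.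
rewrite (bigD1 (Ordinal hi)) //= addKn big1 ?addr0 // => l.
rewrite -val_eqE /= neq_ltn => /orP[lt_l|gt_l].
  rewrite [q`__]nth_default ?mulr0 // (leq_trans hq) //.
  by have := ltn_ord l; lia.
by rewrite nth_default ?mul0r // (leq_trans hp).
Qed.

(** Elements of [{poly {poly k}}] are polynomials in [g] over [k[Omega]]:
    ['X] is [g], ['X%:P] is [Omega], and [p^`()] is the derivative in [g]. *)
Section Constants.
Variables (k : fieldType) (lam : k).
Hypothesis char0 : forall n, ((n%:R : k) == 0) = (n == 0)%N.

Lemma mulrn_inj_char0 (V : lmodType k) (a : V) m n :
  a != 0 -> a *+ m = a *+ n -> m = n.
Proof.
wlog le_mn : m n / (m <= n)%N.
  move=> H a0 e; case/orP: (leq_total m n) => h; first exact: H.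
  by apply/esym/H.
move=> a0 /eqP; rewrite eq_sym -subr_eq0 -mulrnBr // -scaler_nat scaler_eq0.
by rewrite (negPf a0) orbF char0 subn_eq0 => le_nm; apply/eqP; rewrite eqn_leq le_mn.
Qed.

Lemma coef_euler (R : nzRingType) (p : {poly R}) i : ('X * p^`())`_i = p`_i *+ i.
Proof. by rewrite coefXM; case: i => [|i]; rewrite ?mulr0n ?coef_deriv. Qed.

Lemma size_euler (R : nzRingType) (p : {poly R}) : (size ('X * p^`())%R <= size p)%N.
Proof.
by apply/leq_sizeP => j hj; rewrite coef_euler nth_default ?mul0rn.
Qed.

(** Solutions [b / s] would be constant multiples of [g^(-1/2)]: comparing top
    coefficients gives [2 deg s = 2 deg b + 1]. *)
Lemma euler_half_eq0 (s b : {poly k}) :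
  s != 0 -> 'X * s^`() * b *+ 2 = s * ('X * b^`()) *+ 2 + s * b -> b = 0.
Proof.
move=> s0 e; apply/eqP/negP => /negP b0.
pose m := (size s).-1; pose n := (size b).-1.
have sm : size s = m.+1 by rewrite prednK ?size_poly_gt0.
have sn : size b = n.+1 by rewrite prednK ?size_poly_gt0.
have : ('X * s^`() * b *+ 2)`_(m + n) =
  (s * ('X * b^`()) *+ 2 + s * b)`_(m + n) by rewrite e.
rewrite coefMn [RHS]coefD coefMn !coefM_top ?(leq_trans (size_euler _)) ?sm ?sn //.
rewrite !coef_euler mulrnAl mulrnAr -!mulrnA -mulrSr.
have /(@mulrn_inj_char0 k^o) h : s`_m * b`_n != 0.
  by rewrite mulf_neq0 // -?lead_coefE ?lead_coef_eq0.
by move/h; lia.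
Qed.

(** The combination [r = lead_coef s * a - a_n * s], with [n = deg s], solves the
    same equation [s' r = s r'], whose top coefficients force [deg r = n] unless
    [r = 0]; but the coefficient of [g^n] in [r] vanishes. *)
Lemma wronskian_eq0 (s a : {poly {poly k}}) :
  s != 0 -> s^`() * a = s * a^`() -> lead_coef s *: a = a`_(size s).-1 *: s.
Proof.
move=> s0 e; apply/eqP; rewrite -subr_eq0.
set r := _ - _; apply/negP => /negP r0.
have er : 'X * s^`() * r = s * ('X * r^`()).
  by rewrite /r derivB !derivZ -!mul_polyC; ring: e.
pose m := (size s).-1; pose n := (size r).-1.
have sm : size s = m.+1 by rewrite prednK ?size_poly_gt0.
have sn : size r = n.+1 by rewrite prednK ?size_poly_gt0.
have : ('X * s^`() * r)`_(m + n) = (s * ('X * r^`()))`_(m + n) by rewrite er.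
rewrite !coefM_top ?(leq_trans (size_euler _)) ?sm ?sn //.
rewrite !coef_euler mulrnAl mulrnAr.
have /mulrn_inj_char0 h : s`_m * r`_n != 0.
  by rewrite mulf_neq0 // -?lead_coefE ?lead_coef_eq0.
move/h => emn; have : r`_m = 0.
  by rewrite /r coefB !coefZ lead_coefE -/m mulrC subrr.
by move/eqP; rewrite emn -lead_coefE lead_coef_eq0 (negPf r0).
Qed.

(** The polynomial whose value at [Omega] and [g] is [x^2]. *)
Definition xsq : {poly {poly k}} := 'X%:P * 'X + (2 * lam)%:P%:P * (1 + 'X^2).

Lemma swapXY_xsq :
  swapXY xsq = 'X * 'X%:P + ((2 * lam) *: (1 + 'X^2))%:P.
Proof.
rewrite /xsq !expr2 !(rmorphD, rmorphM, rmorph1) /= !swapXY_polyC swapXY_X.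
by rewrite map_polyX !map_polyC -mul_polyC !(rmorphD, rmorphM, rmorph1).
Qed.

Lemma size_swapXY_xsq : size (swapXY xsq) = 2%N.
Proof.
rewrite swapXY_xsq mulrC size_MXaddC polyC_eq0 polyX_eq0 /= size_polyC.
by rewrite polyX_eq0.
Qed.

(** [x^2] has odd degree (one) in [Omega], hence is not a square of a fraction;
    this is why [a + b x] has nonzero norm [a^2 - x^2 b^2]. *)
Lemma xsq_norm_eq0 (a b : {poly {poly k}}) :
  a ^+ 2 = xsq * b ^+ 2 -> a = 0 /\ b = 0.
Proof.
move=> e; have xsq0 : xsq != 0.
  by rewrite -swapXY_eq0 -size_poly_eq0 size_swapXY_xsq.
suff b0 : b = 0.
  by split=> //; apply/eqP; rewrite -sqrf_eq0 e b0 expr0n mulr0.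
apply/eqP/negP => /negP b0.
have a0 : a != 0.
  by rewrite -sqrf_eq0 e mulf_neq0 ?expf_neq0.
have := congr1 (fun p => size (swapXY p)) e.
rewrite /= !rmorphM /= size_mul ?swapXY_eq0 //.
rewrite size_mul ?mulf_neq0 ?swapXY_eq0 // size_swapXY_xsq.
rewrite size_mul ?swapXY_eq0 //.
have : size (swapXY a) != 0%N by rewrite size_poly_eq0 swapXY_eq0.
have : size (swapXY b) != 0%N by rewrite size_poly_eq0 swapXY_eq0.
by move: (size (swapXY a)) (size (swapXY b)); lia.
Qed.

Lemma coef_swapXY_deriv (p : {poly {poly k}}) i :
  (swapXY p^`())`_i = ((swapXY p)`_i)^`().
Proof.
by apply/polyP => j; rewrite coef_swapXY !coef_deriv coef_swapXY coefMn.
Qed.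

Lemma size_swapXY_deriv (p : {poly {poly k}}) :
  (size (swapXY p^`()) <= size (swapXY p))%N.
Proof.
apply/leq_sizeP => j hj; rewrite coef_swapXY_deriv nth_default //.
exact: deriv0.
Qed.

(** The equation says that [x^2 (b / s)^2] is a constant. Its leading
    coefficients in [Omega] satisfy the same equation with [x^2] replaced by its
    leading coefficient [g], which has no square root among rational functions
    of [g]. *)
Lemma xsq_sqrt_eq0 (s b : {poly {poly k}}) :
  s != 0 ->
  xsq * (s^`() * b) *+ 2 = xsq * (s * b^`()) *+ 2 + xsq^`() * (s * b) -> b = 0.
Proof.
move=> s0 e; apply/eqP/negP => /negP b0.
pose S := swapXY s; pose B := swapXY b.
pose m := (size S).-1; pose n := (size B).-1.
have sS : size S = m.+1 by rewrite prednK ?size_poly_gt0 ?swapXY_eq0.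
have sB : size B = n.+1 by rewrite prednK ?size_poly_gt0 ?swapXY_eq0.
have top (u v w : {poly {poly k}}) : (size (swapXY u) <= 2)%N ->
    (size (swapXY v) <= m.+1)%N -> (size (swapXY w) <= n.+1)%N ->
    (swapXY (u * (v * w)))`_(1 + (m + n))
      = (swapXY u)`_1 * ((swapXY v)`_m * (swapXY w)`_n).
  move=> hu hv hw; rewrite !rmorphM coefM_top //; first by rewrite coefM_top.
  apply: leq_trans (size_polyMleq _ _) _; move: hv hw.
  by move: (size (swapXY v)) (size (swapXY w)); lia.
have hD (p : {poly {poly k}}) d :
    (size (swapXY p) <= d)%N -> (size (swapXY p^`()) <= d)%N.
  exact: leq_trans (size_swapXY_deriv p).
have xsq1 : (swapXY xsq)`_1 = 'X.
  by rewrite swapXY_xsq coefD coefXM !coefC addr0.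
have : (swapXY (xsq * (s^`() * b) *+ 2))`_(1 + (m + n)) =
  (swapXY (xsq * (s * b^`()) *+ 2 + xsq^`() * (s * b)))`_(1 + (m + n)).
  by rewrite e.
rewrite rmorphMn coefMn [in RHS]rmorphD [RHS]coefD [in RHS]rmorphMn coefMn.
rewrite !top ?hD ?size_swapXY_xsq -?/S -?/B ?sS ?sB //.
rewrite !coef_swapXY_deriv xsq1 derivX mul1r !mulrA.
rewrite -['X * S`_m * _]mulrA ['X * (S`_m * _)]mulrCA -/S -/B => h.
have Sm0 : S`_m != 0 by rewrite -lead_coefE lead_coef_eq0 swapXY_eq0.
have /eqP := euler_half_eq0 Sm0 h.
by rewrite -lead_coefE lead_coef_eq0 swapXY_eq0 (negPf b0).
Qed.

End Constants.

(** * The commutative subalgebra generated by g, g^-1 and x *)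

Section OreAlgebra.
Variables (k : fieldType) (lam : k) (A : algType k) (g gi x y : A).
Hypothesis char0 : forall n, ((n%:R : k) == 0) = (n == 0)%N.
Hypothesis rel : relations lam g gi x y.

Lemma two_neq0 : (2 : k) != 0.
Proof. by rewrite char0. Qed.

Let ggi : g * gi = 1. Proof. by case: rel. Qed.
Let gig : gi * g = 1. Proof. by case: rel. Qed.
Let gx : g * x = x * g. Proof. by case: rel. Qed.
Let yg : y * g - g * y = - (x * g). Proof. by case: rel. Qed.
Let yx : y * x - x * y = - (2^-1 *: x ^+ 2) + lam *: (1 - g ^+ 2).
Proof. by case: rel. Qed.

Let gix : gi * x = x * gi.
Proof. by rewrite -[LHS]mulr1 -ggi mulrA -[gi * x * g]mulrA -gx mulrA gig mul1r. Qed.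

Definition coef_alg : {pred A} := subalg_pred [set` [:: g; gi; x]].
HB.instance Definition _ := GRing.SubalgClosed.on coef_alg.

Lemma coef_alg_g : g \in coef_alg.
Proof. by apply/subalg_predP; apply: subalg_gen_sub; exact: (@mem_nth _ 0 [:: g; gi; x] 0). Qed.

Lemma coef_alg_gi : gi \in coef_alg.
Proof. by apply/subalg_predP; apply: subalg_gen_sub; exact: (@mem_nth _ 0 [:: g; gi; x] 1). Qed.

Lemma coef_alg_x : x \in coef_alg.
Proof. by apply/subalg_predP; apply: subalg_gen_sub; exact: (@mem_nth _ 0 [:: g; gi; x] 2). Qed.

Hint Resolve coef_alg_g coef_alg_gi coef_alg_x : core.

Lemma coef_alg_ind (B : set A) :
  subalg B -> B g -> B gi -> B x -> forall u, u \in coef_alg -> B u.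
Proof.
move=> hB hg hgi hx u /subalg_predP hu; apply: (subalg_gen_min hB) hu.
by move=> v /=; rewrite !inE => /or3P[] /eqP->.
Qed.

Lemma coef_alg_comm u v : u \in coef_alg -> v \in coef_alg -> u * v = v * u.
Proof.
move=> /subalg_predP hu /subalg_predP hv; apply: (subalg_gen_comm _ hu hv).
move=> {hu hv}u {}v; rewrite /GRing.comm /= !inE.
by move=> /or3P[] /eqP-> /or3P[] /eqP->; rewrite ?ggi ?gig ?gx ?gix.
Qed.

Definition delta u := y * u - u * y.

Lemma delta_is_linear : linear delta.
Proof.
move=> a u v; rewrite /delta mulrDr mulrDl -scalerAr -scalerAl scalerBr opprD.
by rewrite addrACA.
Qed.
HB.instance Definition _ := GRing.isLinear.Build k A A *:%R delta delta_is_linear.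

Lemma deltaM u v : delta (u * v) = delta u * v + u * delta v.
Proof. by rewrite /delta mulrBl mulrBr !mulrA addrA subrK. Qed.

Lemma delta1 : delta 1 = 0.
Proof. by rewrite /delta mulr1 mul1r subrr. Qed.

Lemma delta_gi : delta gi = x * gi.
Proof.
have : delta (gi * g) = 0 by rewrite gig delta1.
rewrite deltaM [delta g]yg mulrN mulrA => /subr0_eq h.
by rewrite -[LHS]mulr1 -ggi mulrA h gix -!mulrA ggi mulr1.
Qed.

Lemma coef_alg_delta u : u \in coef_alg -> delta u \in coef_alg.
Proof.
move=> hu; suff [] : u \in coef_alg /\ delta u \in coef_alg by [].
apply: (coef_alg_ind (B := [set u | u \in coef_alg /\ delta u \in coef_alg])) hu.
- split=> [|a v w [hv hdv] [hw hdw]|v w [hv hdv] [hw hdw]] /=.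
  + by rewrite delta1 rpred0 rpred1.
  + by split; rewrite ?linearP; apply: rpredD => //; apply: rpredZ.
  + by split; [exact: rpredM | rewrite deltaM; apply: rpredD; exact: rpredM].
- by rewrite /= [delta g]yg rpredN rpredM.
- by rewrite /= delta_gi rpredM.
- rewrite /= [delta x]yx rpredD ?rpredN ?rpredZ ?rpredB ?rpredX ?rpred1 //.
Qed.

Definition omega : A := x ^+ 2 * gi - (2 * lam) *: (gi + g).

Lemma coef_alg_omega : omega \in coef_alg.
Proof. by rewrite rpredB ?rpredZ ?rpredM ?rpredX ?rpredD. Qed.
Hint Resolve coef_alg_omega : core.

(** The reason for choosing [Omega] and [g] as coordinates: [x] is quadratic
    over them. *)
Lemma x_sq : x ^+ 2 = omega * g + (2 * lam) *: (1 + g ^+ 2).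
Proof.
rewrite /omega mulrBl -(mulrA (x ^+ 2)) gig mulr1 -scalerAl.
rewrite [(gi + g) * g]mulrDl gig -expr2.
by rewrite subrK.
Qed.

Lemma delta_omega : delta omega = 0.
Proof.
have dx : delta x * x + x * delta x
    = - x ^+ 3 + (2 * lam) *: (x - x * g ^+ 2).
  have -> : delta x * x = x * delta x.
    by apply: coef_alg_comm => //; apply: coef_alg_delta.
  rewrite -mulr2n -scaler_nat [delta x]yx mulrDr mulrN -!scalerAr -exprS.
  rewrite scalerDr scalerN !scalerA divff ?two_neq0 // scale1r mulrBr mulr1.
  by [].
rewrite /omega linearB linearZ linearD /= deltaM [delta g]yg delta_gi.
rewrite [delta (x ^+ 2)]deltaM dx.
have -> : (- x ^+ 3 + (2 * lam) *: (x - x * g ^+ 2)) * gi =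
  - (x ^+ 3 * gi) + (2 * lam) *: (x * gi - x * g).
  rewrite mulrDl mulNr -scalerAl mulrBl -mulrA expr2 -!mulrA ggi mulr1.
  by [].
by rewrite mulrA -exprSr addrAC addrK addNr.
Qed.

Local Notation ev0 := (horner_alg omega).

Lemma coef_alg_ev0 p : ev0 p \in coef_alg.
Proof.
elim/poly_ind: p => [|p c IH]; first by rewrite rmorph0 rpred0.
rewrite rmorphD rmorphM /= horner_algX horner_algC.
by rewrite rpredD ?rpredM ?rpredZ ?rpred1.
Qed.

Lemma delta_ev0M p u : delta (ev0 p * u) = ev0 p * delta u.
Proof.
rewrite deltaM; suff -> : delta (ev0 p) = 0 by rewrite mul0r add0r.
elim/poly_ind: p => [|p c IH]; first by rewrite rmorph0 linear0.
rewrite rmorphD rmorphM /= horner_algX horner_algC linearD /= deltaM delta_omega.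
by rewrite IH linearZ /= delta1 mul0r mulr0 scaler0 !addr0.
Qed.

Lemma ev_comm : commr_rmorph (horner_alg omega) g.
Proof. by move=> p; apply: coef_alg_comm => //; apply: coef_alg_ev0. Qed.

(** Evaluation of polynomials in [g] over [k[Omega]]. *)
Definition ev : {poly {poly k}} -> A := horner_morph ev_comm.
HB.instance Definition _ := GRing.RMorphism.on ev.

Lemma evX : ev 'X = g. Proof. exact: horner_morphX. Qed.
Lemma evC p : ev p%:P = ev0 p. Proof. exact: horner_morphC. Qed.

Lemma coef_alg_ev p : ev p \in coef_alg.
Proof.
elim/poly_ind: p => [|p c IH]; first by rewrite rmorph0 rpred0.
by rewrite rmorphD rmorphM /= evX evC rpredD ?rpredM ?coef_alg_ev0.
Qed.
Hint Resolve coef_alg_ev : core.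

Lemma ev_xsq : ev (xsq lam) = x ^+ 2.
Proof.
rewrite x_sq /xsq; move: (2 * lam) => c; rewrite !expr2 !(rmorphD, rmorphM, rmorph1) /= !evX !evC.
by rewrite horner_algX horner_algC mulr_algl.
Qed.

Lemma delta_ev p : delta (ev p) = - (ev ('X * p^`()) * x).
Proof.
elim/poly_ind: p => [|p c IH].
  by rewrite derivC mulr0 !rmorph0 linear0 mul0r oppr0.
rewrite derivD derivC addr0 derivM derivX mulr1.
have -> : 'X * (p^`() * 'X + p) = 'X * p^`() * 'X + p * 'X.
  by rewrite mulrDr mulrA [p * _]mulrC.
move: ('X * p^`()) IH => q IH.
rewrite !rmorphD !rmorphM /= linearD /= evX evC.
rewrite -[ev0 c]mulr1 delta_ev0M delta1 mulr0 addr0 deltaM IH [delta g]yg.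
by rewrite mulrN mulNr -opprD mulrDl -!mulrA gx.
Qed.

(** Up to a power of [g^-1], every element of the subalgebra has this form,
    for unique [a] and [b]. *)
Definition nf (a b : {poly {poly k}}) : A := ev a + ev b * x.

Lemma coef_alg_nf a b : nf a b \in coef_alg.
Proof. by rewrite rpredD ?rpredM. Qed.

Lemma nfD a b c d : nf a b + nf c d = nf (a + c) (b + d).
Proof. by rewrite /nf !rmorphD mulrDl addrACA. Qed.

Lemma nfM a b c d :
  nf a b * nf c d = nf (a * c + xsq lam * (b * d)) (a * d + b * c).
Proof.
have xev p : x * ev p = ev p * x by apply: coef_alg_comm.
have xsqC p : x ^+ 2 * ev p = ev p * x ^+ 2.
  by rewrite expr2 -mulrA xev mulrA xev -mulrA.
rewrite /nf; move: (xsq lam) ev_xsq => q eq_q.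
rewrite !rmorphD !rmorphM /= eq_q mulrA xsqC -[_ * x ^+ 2 * _]mulrA xsqC.
rewrite !mulrDl !mulrDr.
rewrite -[ev b * x * ev c]mulrA -[ev b * x * (_ * x)]mulrA [x * (_ * x)]mulrA.
rewrite !xev -[ev d * x * x]mulrA -expr2 !mulrA.
by rewrite -!addrA; congr (_ + _); rewrite addrA [RHS]addrC.
Qed.

(** The factor 2 avoids halves in polynomial identities. *)
Lemma delta_x : delta x *+ 2 = - ev ('X * (xsq lam)^`()).
Proof.
have -> : 'X * (xsq lam)^`() = 'X%:P * 'X + (2 * lam)%:P%:P * ('X * 'X *+ 2).
  rewrite /xsq derivD !derivM !derivC derivD derivC derivXn derivX /=.
  by rewrite !mul0r !add0r mulr1 expr1; ring.
have -> : delta x *+ 2 = - x ^+ 2 + (2 * lam) *: (1 - g ^+ 2).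
  rewrite [delta x]yx -scaler_nat scalerDr scalerN !scalerA divff ?two_neq0 //.
  by rewrite scale1r.
rewrite x_sq; move: (2 * lam) => c.
rewrite !expr2 rmorphD !rmorphM rmorphMn rmorphM /= !evX !evC.
rewrite horner_algX horner_algC mulr_algl opprD -addrA -scalerN -scalerDr.
have -> : - (1 + g * g) + (1 - g * g) = - (g * g *+ 2).
  by rewrite opprD addrACA addNr add0r -mulr2n mulNrn.
by rewrite scalerN -opprD.
Qed.

Lemma delta_nf a b : delta (nf a b) *+ 2 =
  - nf (xsq lam * ('X * b^`()) *+ 2 + 'X * (xsq lam)^`() * b) ('X * a^`() *+ 2).
Proof.
rewrite /nf linearD /= deltaM !delta_ev mulrnDl mulrnDl.
rewrite -[(ev b * _) *+ 2]mulrnAr delta_x.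
move: ('X * a^`()) ('X * b^`()) ('X * (xsq lam)^`()) => p q r.
move: (xsq lam) ev_xsq => s ev_s.
rewrite rmorphD !rmorphMn !rmorphM /= ev_s.
rewrite (@coef_alg_comm (x ^+ 2)) ?rpredX // (@coef_alg_comm (ev r)) //.
rewrite mulNr -mulrA -expr2 mulrN !mulNrn mulrnAl.
by rewrite addrC !opprD.
Qed.

Lemma coef_alg_normal u :
  u \in coef_alg -> exists N a b, u = gi ^+ N * nf a b.
Proof.
have ev1 : ev 1 = 1 by rewrite rmorph1.
have giC N a b : gi ^+ N * nf a b = nf a b * gi ^+ N.
  by apply: coef_alg_comm; rewrite ?rpredX ?coef_alg_nf.
have ggN N : gi ^+ N * g ^+ N = 1.
  by rewrite -exprMn_comm ?gig ?expr1n // /GRing.comm gig ggi.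
have raise N M a b : gi ^+ N * nf a b = gi ^+ (N + M) * nf ('X ^+ M * a) ('X ^+ M * b).
  rewrite exprD -mulrA; congr (_ * _).
  rewrite /nf !rmorphM rmorphXn /= evX -mulrA -mulrDr mulrA ggN mul1r //.
apply: (coef_alg_ind (B := [set u | exists N a b, u = gi ^+ N * nf a b])).
- split=> [|c u' v [N [a [b ->]]] [M [a' [b' ->]]]|u' v [N [a [b ->]]] [M [a' [b' ->]]]] /=.
  + by exists 0%N, 1, 0; rewrite /nf ev1 rmorph0 mul0r addr0 mulr1.
  + rewrite (raise N M a b) (raise M N a' b') [(M + N)%N]addnC scalerAr -mulr_algl.
    have -> : c%:A * nf ('X ^+ M * a) ('X ^+ M * b)
      = nf (c%:P%:P * ('X ^+ M * a)) (c%:P%:P * ('X ^+ M * b)).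
      by rewrite /nf !(rmorphM ev c%:P%:P) /= evC horner_algC -mulrA mulrDr.
    rewrite -mulrDr nfD; exists (N + M)%N.
    exists (c%:P%:P * ('X ^+ M * a) + 'X ^+ N * a').
    by exists (c%:P%:P * ('X ^+ M * b) + 'X ^+ N * b').
  + rewrite -mulrA [nf a b * _]mulrA -giC -mulrA mulrA -exprD nfM.
    exists (N + M)%N, (a * a' + xsq lam * (b * b')).
    by exists (a * b' + b * a').
- by exists 0%N, 'X, 0; rewrite /nf evX rmorph0 mul0r addr0 mul1r.
- by exists 1%N, 1, 0; rewrite /nf ev1 rmorph0 mul0r addr0 mulr1.
- by exists 0%N, 0, 1; rewrite /nf ev1 rmorph0 mul1r add0r mul1r.
Qed.

(** * Uniqueness of normal forms, and zero divisors *)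

Variable coords : A -> ore_space k.
Hypothesis coords_linear : linear coords.
Hypothesis coords1 : coords 1 = @ore1 k.
Hypothesis coords_g : forall u, coords (g * u) = fun n => lau_shift 1 (coords u n).
Hypothesis coords_gi : forall u, coords (gi * u) = fun n => lau_shift (-1) (coords u n).
Hypothesis coords_x : forall u, coords (x * u) = fun n => lau_x lam (coords u n).
Hypothesis coords_y : forall u, coords (y * u) = ore_y lam (coords u).

Let coords0 : coords 0 = 0. Proof. exact: linear_morph0 coords_linear. Qed.

Let coordsD u v n : coords (u + v) n = coords u n + coords v n.
Proof. by rewrite -[u]scale1r coords_linear !scale1r. Qed.

Let coordsZ c u n : coords (c *: u) n = c *: coords u n.
Proof. by rewrite -[c *: u]addr0 coords_linear coords0 addr0. Qed.

(** On the module, [Omega] is multiplication by the indeterminate. *)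
Lemma coords_omega u n j :
  coords (omega * u) n j = ('X * (coords u n j).1, 'X * (coords u n j).2).
Proof.
have -> : omega * u = x * (x * (gi * u)) + - (2 * lam) *: (gi * u + g * u).
  by rewrite /omega mulrBl -scalerAl [(gi + g) * u]mulrDl scaleNr expr2 -!mulrA.
rewrite coordsD coordsZ coordsD.
rewrite !coords_x coords_gi coords_g; set f := coords u n.
rewrite -[LHS]/(lau_x lam (lau_x lam (lau_shift (-1) f)) j
  + (- (2 * lam)) *: (lau_shift (-1) f j + lau_shift 1 f j)).
have e1 (i : int) : i - 1 + 1 = i by rewrite subrK.
have e2 (i : int) : i - 2 + 1 = i - 1 by ring.
rewrite [LHS]surjective_pairing; congr pair; rewrite /= /lau_shift !opprK ?e1 ?e2.
  by rewrite scalerDr scaleNr; ring.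
by rewrite scaleNr addrK.
Qed.

Lemma coords_ev0 p u n j :
  coords (ev0 p * u) n j = (p * (coords u n j).1, p * (coords u n j).2).
Proof.
elim/poly_ind: p => [|p c IH] in u *.
  by rewrite rmorph0 mul0r coords0 !mul0r.
rewrite rmorphD rmorphM /= horner_algX horner_algC mulrDl -mulrA mulr_algl.
rewrite coordsD coordsZ -[LHS]/(_ + c *: coords u n j) IH coords_omega.
by rewrite [LHS]surjective_pairing; congr pair; rewrite /= mulrDl mulrA -mul_polyC.
Qed.

Definition laurent_of_poly (p : {poly {poly k}}) (j : int) : {poly k} :=
  if j is Posz i then p`_i else 0.

Lemma laurent_of_polyMXaddC p c j : laurent_of_poly (p * 'X + c%:P) j
  = laurent_of_poly p (j - 1) + (if j == 0 then c else 0).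
Proof.
case: j => [[|i]|i].
- by rewrite /= coefD coefMX coefC.
- have -> : i.+1%:Z - 1 = i%:Z by rewrite intS addrC addKr.
  by rewrite /= coefD coefMX coefC.
- have -> : Negz i - 1 = Negz i.+1 by rewrite !NegzE -opprD -PoszD addn1.
  by rewrite addr0.
Qed.

Lemma coords_ev p u n v : coords u n = (fun j => if j == 0 then v else 0) ->
  coords (ev p * u) n
  = fun j => (laurent_of_poly p j * v.1, laurent_of_poly p j * v.2).
Proof.
move=> hu; elim/poly_ind: p => [|p c IH].
  rewrite rmorph0 mul0r coords0; apply/funext => j.
  by case: j => i; rewrite /= ?coef0 !mul0r.
rewrite rmorphD rmorphM /= evX evC mulrDl coordsD.
rewrite -(coef_alg_comm coef_alg_g (coef_alg_ev p)) -mulrA coords_g IH.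
apply/funext => j; rewrite laurent_of_polyMXaddC !mulrDl.
rewrite -[LHS]/(lau_shift 1 _ j + coords (ev0 c * u) n j) coords_ev0 hu /lau_shift.
by case: eqP => _ /=; rewrite ?mulr0 ?mul0r.
Qed.

Lemma coords_nf a b :
  coords (nf a b) 0%N = fun j => (laurent_of_poly a j, laurent_of_poly b j).
Proof.
rewrite /nf coordsD -[ev a]mulr1 (@coords_ev _ _ _ (1, 0)) ?coords1 //.
rewrite (@coords_ev _ _ _ (0, 1)); last first.
  rewrite -[x]mulr1 coords_x coords1; apply/funext => j.
  rewrite /lau_x /ore1 /=.
  by case: eqP => _; case: eqP => _; case: eqP => _; rewrite /= ?addr0 ?mulr0 ?scaler0 ?addr0.
apply/funext => j.
rewrite -[LHS]/(_ + (laurent_of_poly b j * 0, laurent_of_poly b j * 1)).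
by rewrite [LHS]surjective_pairing; congr pair; rewrite /= !mulr0 mulr1 ?addr0 ?add0r.
Qed.

Lemma nf_eq0 a b : nf a b = 0 -> a = 0 /\ b = 0.
Proof.
move=> /(congr1 (fun u => coords u 0%N)); rewrite coords_nf coords0 => e.
by split; apply/polyP => i; have /(congr1 (@^~ i%:Z)) [] := e; rewrite coef0.
Qed.

Lemma nf_inj a b c d : nf a b = nf c d -> a = c /\ b = d.
Proof.
have nfN : - nf c d = nf (- c) (- d) by rewrite /nf !rmorphN mulNr opprD.
move/eqP; rewrite -subr_eq0 nfN nfD => /eqP/nf_eq0[/subr0_eq-> /subr0_eq->].
by [].
Qed.

Lemma giN_inj N u : gi ^+ N * u = 0 -> u = 0.
Proof.
move=> /(congr1 ( *%R (g ^+ N))); rewrite mulr0 mulrA -exprMn_comm.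
  by rewrite ggi expr1n mul1r.
by rewrite /GRing.comm ggi gig.
Qed.

(** The conjugate [a - b x] turns [a + b x] into a polynomial in [g] over
    [k[Omega]]. *)
Lemma nf_norm a b : nf a b != 0 ->
  exists2 s, s != 0 & nf a (- b) * nf a b = ev s.
Proof.
move=> ab0; exists (a ^+ 2 - xsq lam * b ^+ 2).
  apply: contra_neq ab0 => /subr0_eq/xsq_norm_eq0[-> ->].
  by rewrite /nf rmorph0 mul0r addr0.
rewrite nfM -[RHS]addr0 -(mul0r x) -[in RHS](rmorph0 ev) -/(nf _ 0).
by congr nf; rewrite ?expr2; ring.
Qed.

Lemma ev_mul_nf_eq0 s a b : s != 0 -> ev s * nf a b = 0 -> nf a b = 0.
Proof.
move=> s0; rewrite /nf mulrDr mulrA -!rmorphM => /nf_eq0[/eqP + /eqP].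
rewrite !mulf_eq0 (negPf s0) /= => /eqP-> /eqP->.
by rewrite rmorph0 mul0r addr0.
Qed.

(** After multiplication by the conjugate of [u] the factor on the left acts
    componentwise on normal forms, by a nonzero polynomial. *)
Lemma coef_alg_domain u v :
  u \in coef_alg -> v \in coef_alg -> u != 0 -> u * v = 0 -> v = 0.
Proof.
move=> hu hv u0 uv0.
have [N [a [b eu]]] := coef_alg_normal hu.
have [M [c [d ev']]] := coef_alg_normal hv.
have ab0 : nf a b != 0 by apply: contra_neq u0; rewrite eu => ->; rewrite mulr0.
have [s s0 es] := nf_norm ab0.
rewrite ev' (@ev_mul_nf_eq0 s) ?mulr0 // -es -mulrA.
suff -> : nf a b * nf c d = 0 by rewrite mulr0.
apply: (@giN_inj (N + M)); rewrite exprD.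
have hM : gi ^+ M \in coef_alg by rewrite rpredX.
rewrite -mulrA (mulrA (gi ^+ M)) (coef_alg_comm hM (coef_alg_nf a b)).
by rewrite -mulrA mulrA -eu -ev'.
Qed.

(** * Powers of y form a basis over the subalgebra *)

(** Elements of the subalgebra act on each power of [y] separately. *)
Lemma coef_alg_coords u : u \in coef_alg ->
  exists L : laurent k -> laurent k, forall v n, coords (u * v) n = L (coords v n).
Proof.
apply: (coef_alg_ind (B := [set u | exists L : laurent k -> laurent k,
  forall v n, coords (u * v) n = L (coords v n)])).
- split=> [|c v w [L hL] [L' hL']|v w [L hL] [L' hL']] /=.
  + by exists id => v n; rewrite mul1r.
  + exists (fun f => c *: L f + L' f) => t n.
    by rewrite mulrDl -scalerAl coordsD coordsZ hL hL'.
  + by exists (L \o L') => t n; rewrite -mulrA hL hL'.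
- by exists (lau_shift 1) => v n; rewrite coords_g.
- by exists (lau_shift (-1)) => v n; rewrite coords_gi.
- by exists (lau_x lam) => v n; rewrite coords_x.
Qed.

Lemma coef_alg_coords_eq0 u : u \in coef_alg -> coords u 0%N = 0 -> u = 0.
Proof.
move=> hu u0; have [N [a [b eu]]] := coef_alg_normal hu.
have hgN : g ^+ N \in coef_alg by rewrite rpredX.
have ggN : g ^+ N * gi ^+ N = 1.
  by rewrite -exprMn_comm ?ggi ?expr1n // /GRing.comm ggi gig.
have [L hL] := coef_alg_coords hgN.
have L0 : L 0 = 0 by have := hL 0 0%N; rewrite mulr0 coords0 => /esym.
have : coords (nf a b) 0%N = 0 by rewrite -[nf a b]mul1r -ggN -mulrA -eu hL u0 L0.
rewrite coords_nf => e; rewrite eu.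
have -> : a = 0 by apply/polyP => i; have /(congr1 (@^~ i%:Z)) [] := e; rewrite coef0.
have -> : b = 0 by apply/polyP => i; have /(congr1 (@^~ i%:Z)) [] := e; rewrite coef0.
by rewrite /nf rmorph0 mul0r addr0 mulr0.
Qed.

Lemma coords_yX i n : coords (y ^+ i) n = if n == i then @ore1 k 0%N else 0.
Proof.
elim: i n => [|i IH] n; first by rewrite expr0 coords1; case: n.
have lau_d1 : lau_d lam (@ore1 k 0%N) = 0.
  apply/funext => j; rewrite /lau_d /ore1 /=.
  rewrite [LHS]surjective_pairing [RHS]surjective_pairing; congr pair => /=.
    by do 3!case: eqP => ? /=; rewrite !(mulr0, scaler0, addr0, oppr0).
  by case: eqP => [->|_] /=; rewrite ?scaler0 ?scale0r ?oppr0.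
rewrite exprS coords_y /ore_y.
have -> : lau_d lam (coords (y ^+ i) n) = 0.
  rewrite IH; case: eqP => _ //.
  by apply: linear_morph0; apply: lau_d_linear.
by rewrite addr0; case: n => [|n] //; rewrite IH.
Qed.

Lemma y_free (P : {poly A}) : P \is a polyOver coef_alg -> P.[y] = 0 -> P = 0.
Proof.
move=> /polyOverP hP P0; apply/polyP => n; rewrite coef0.
have coords_sum m (F : 'I_m -> A) : coords (\sum_(i < m) F i) n = \sum_(i < m) coords (F i) n.
  apply: (big_morph (fun u => coords u n)); first by move=> u v; exact: coordsD.
  by rewrite coords0.
apply: coef_alg_coords_eq0 => //.
have : coords P.[y] n = 0 by rewrite P0 coords0.
rewrite horner_coef coords_sum => e0; rewrite -[RHS]e0 {e0}.
have term (i : nat) : coords (P`_i * y ^+ i) n = if n == i then coords P`_i 0%N else 0.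
  have [L hL] := coef_alg_coords (hP i).
  have L0 : L 0 = 0 by have := hL 0 0%N; rewrite mulr0 coords0 => /esym.
  by rewrite hL coords_yX -[P`_i in RHS]mulr1 hL coords1; case: eqP.
under eq_bigr => i _ do rewrite term.
have [lt_n|le_n] := ltnP n (size P).
  rewrite (bigD1 (Ordinal lt_n)) //= eqxx big1 ?addr0 // => i.
  by rewrite -val_eqE /= eq_sym => /negPf->.
rewrite nth_default // coords0 big1 // => i _; case: eqP => // e.
by move: (ltn_ord i); rewrite -e ltnNge le_n.
Qed.

Lemma y_free_inj (P Q : {poly A}) : P \is a polyOver coef_alg ->
  Q \is a polyOver coef_alg -> P.[y] = Q.[y] -> P = Q.
Proof.
move=> hP hQ e; apply/subr0_eq/y_free; first exact: rpredB.
by rewrite hornerD hornerN e subrr.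
Qed.

(** Left multiplication by [y] in terms of left polynomials in [y], which
    are read as [P.[y] = sum_i P_i y^i]. *)
Definition ymul (P : {poly A}) : {poly A} := P * 'X + map_poly delta P.

Lemma coef_ymul P i : (ymul P)`_i = (if i is i'.+1 then P`_i' else 0) + delta P`_i.
Proof.
by rewrite coefD coefMX coef_map_id0 ?linear0 //; case: i.
Qed.

Lemma horner_ymul P : (ymul P).[y] = y * P.[y].
Proof.
rewrite hornerD hornerMX.
rewrite (@horner_coef_wide _ (size P) (map_poly delta P)); last first.
  exact: size_poly.
rewrite horner_coef mulr_sumr mulr_suml -big_split /=; apply: eq_bigr => i _.
rewrite coef_map_id0 ?linear0 // /delta mulrBl !mulrA -(mulrA _ (y ^+ i)).
by rewrite -exprSr exprS !mulrA addrC subrK.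
Qed.

Lemma ymul_over P : P \is a polyOver coef_alg -> ymul P \is a polyOver coef_alg.
Proof.
move=> /polyOverP hP; apply/polyOverP => i; rewrite coef_ymul.
by apply: rpredD; [case: i => [|i] //; exact: rpred0 | exact: coef_alg_delta].
Qed.

Hypothesis gen : forall B : set A,
  subalg B -> B g -> B gi -> B x -> B y -> forall u, B u.

(** The elements [u] such that [u P(y)] is again a left polynomial in [y],
    for every left polynomial [P], form a subalgebra containing the generators. *)
Lemma y_span u : exists2 P : {poly A}, P \is a polyOver coef_alg & u = P.[y].
Proof.
pose B : set A := [set u | forall P : {poly A}, P \is a polyOver coef_alg ->
  exists2 Q : {poly A}, Q \is a polyOver coef_alg & u * P.[y] = Q.[y]].
suff hB : B u.
  have [|Q hQ e] := hB 1; first exact: rpred1.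
  by exists Q => //; rewrite -e hornerC mulr1.
have BC c : c \in coef_alg -> B c.
  move=> hc P hP; exists (c%:P * P); last by rewrite hornerCM.
  by rewrite rpredM // polyOverC.
apply: gen => //; try exact: BC; last first.
  by move=> P hP; exists (ymul P); [exact: ymul_over | rewrite horner_ymul].
split=> [|c v w hv hw P hP|v w hv hw P hP].
- exact/BC/rpred1.
- have [Q hQ eQ] := hv P hP; have [R hR eR] := hw P hP.
  exists (c%:A%:P * Q + R); last first.
    by rewrite hornerD hornerCM mulr_algl mulrDl -scalerAl eQ eR.
  by apply: rpredD => //; apply: rpredM => //; rewrite polyOverC rpredZ ?rpred1.
- have [Q hQ eQ] := hw P hP; have [R hR eR] := hv Q hQ.
  by exists R => //; rewrite -mulrA eQ eR.
Qed.

(** * Centralizer and constants *)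

Lemma xg_neq0 : x * g != 0.
Proof.
have -> : x * g = nf 0 'X by rewrite /nf rmorph0 add0r evX gx.
by apply/eqP => /nf_eq0[_ /eqP]; rewrite polyX_eq0.
Qed.

(** [W i] is the left polynomial in [y] that represents [y^i g]; its top
    coefficients are [g] and [- i x g]. *)
Let W i := iter i ymul g%:P.

Let horner_W i : (W i).[y] = y ^+ i * g.
Proof.
elim: i => [|i IH]; first by rewrite hornerC mul1r.
by rewrite /W iterS horner_ymul -/(W i) IH exprS mulrA.
Qed.

Let W_over i : W i \is a polyOver coef_alg.
Proof.
by elim: i => [|i IH]; [rewrite polyOverC | rewrite /W iterS ymul_over].
Qed.

Let coef_W_gt i l : (i < l)%N -> (W i)`_l = 0.
Proof.
elim: i l => [|i IH] [|l] // lt_il; first by rewrite coefC.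
by rewrite /W iterS coef_ymul -/(W i) !IH ?linear0 ?addr0 //; lia.
Qed.

Let coef_W_eq i : (W i)`_i = g.
Proof.
elim: i => [|i IH]; first by rewrite coefC.
by rewrite /W iterS coef_ymul -/(W i) IH coef_W_gt ?linear0 ?addr0.
Qed.

Let coef_W_pred i : (W i.+1)`_i = - (x * g) *+ i.+1.
Proof.
elim: i => [|i IH]; rewrite /W iterS coef_ymul -/(W _).
  by rewrite coef_W_eq add0r mulr1n [delta g]yg.
by rewrite IH coef_W_eq [delta g]yg -mulrSr.
Qed.

(** If [u] has degree [n + 1] in [y], the coefficient of [y^n] in [u g - g u] is
    [- (n + 1) u_(n+1) x g], which is nonzero. *)
Lemma centralizer_g u : u * g = g * u -> u \in coef_alg.
Proof.
have [P /[dup] hP /polyOverP hPi ->] := y_span u => e.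
have [le1|] := leqP (size P) 1.
  by rewrite (size1_polyC le1) hornerC.
case sP : (size P) => [|[|n]] // _.
pose T := \sum_(i < size P) (P`_i)%:P * W i.
have eT : T = g%:P * P.
  apply: y_free_inj.
  - by apply: rpred_sum => i _; apply: rpredM; rewrite ?polyOverC.
  - by apply: rpredM => //; rewrite polyOverC.
  rewrite hornerCM -e [P.[y] in RHS]horner_coef mulr_suml horner_sum; apply: eq_bigr => i _.
  by rewrite hornerCM horner_W mulrA.
have := congr1 (fun p : {poly A} => p`_n) eT.
rewrite coefCM coef_sum sP !big_ord_recr /= big1 => [|i _]; last first.
  by rewrite coefCM coef_W_gt ?mulr0.
rewrite add0r !coefCM coef_W_eq coef_W_pred.
rewrite (coef_alg_comm (hPi n)) // => /(canRL (addKr _)).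
rewrite addNr => /eqP; rewrite mulrnAr mulrN -scaler_nat scaler_eq0.
rewrite char0 /= oppr_eq0 (coef_alg_comm (hPi _)) ?rpredM // => /eqP h.
have P0 : P`_n.+1 = 0.
  by apply: coef_alg_domain h; rewrite ?rpredM ?xg_neq0.
by have := lead_coef_eq0 P; rewrite lead_coefE sP P0 eqxx -size_poly_eq0 sP.
Qed.

(** The components of the equation along [1] and [x] are the two differential
    equations solved above. *)
Lemma constants_ratio s a b : s != 0 ->
    delta (ev s) * nf a b = ev s * delta (nf a b) ->
  b = 0 /\ lead_coef s *: a = a`_(size s).-1 *: s.
Proof.
move=> s0 e.
have X0 : ('X : {poly {poly k}}) != 0 by rewrite polyX_eq0.
have two0 : (2 : {poly {poly k}}) != 0.
  have -> : (2 : {poly {poly k}}) = (2 : k)%:P%:P by rewrite !rmorph_nat.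
  by rewrite !polyC_eq0 two_neq0.
have e2 : delta (ev s) *+ 2 * nf a b = ev s * (delta (nf a b) *+ 2).
  by rewrite mulrnAl mulrnAr e.
have ds : delta (ev s) *+ 2 = - nf 0 ('X * s^`() *+ 2).
  by rewrite delta_ev /nf rmorph0 add0r rmorphMn mulrnAl mulNrn.
have es : ev s = nf s 0 by rewrite /nf rmorph0 mul0r addr0.
move: e2; rewrite ds delta_nf es mulNr mulrN => /oppr_inj.
rewrite !nfM !mul0r !addr0 !add0r => /nf_inj[eb ea].
split.
  apply: (xsq_sqrt_eq0 (s := s) char0 s0); apply: (mulfI X0).
  rewrite mulr2n; rewrite !mulr2n in eb.
  by ring: eb.
apply: wronskian_eq0 => //; apply: (mulfI X0); apply: (mulfI two0).
rewrite !mulr2n in ea.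
by ring: ea.
Qed.

Lemma kOmegaP z :
  subalg_gen [set omega] z <-> exists p, z = horner_alg omega p.
Proof.
split=> [|[p ->]].
  apply: (subalg_gen_min (B := [set z | exists p, z = horner_alg omega p])).
    split=> [|a u v [p ->] [q ->]|u v [p ->] [q ->]] /=.
    - by exists 1; rewrite rmorph1.
    - exists (a%:P * p + q).
      by rewrite rmorphD rmorphM /= horner_algC mulr_algl.
    - by exists (p * q); rewrite rmorphM.
  by move=> _ ->; exists 'X; rewrite horner_algX.
apply/subalg_predP; have homega : omega \in subalg_pred [set omega].
  by apply/subalg_predP; apply: subalg_gen_sub.
elim/poly_ind: p => [|p c IH]; first by rewrite rmorph0 rpred0.
rewrite rmorphD rmorphM /= horner_algX horner_algC.
by rewrite rpredD ?rpredM ?rpredZ ?rpred1.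
Qed.

Lemma kOmega_coef_alg z : subalg_gen [set omega] z -> z \in coef_alg.
Proof. by move=> /kOmegaP[p ->]; apply: coef_alg_ev0. Qed.

Lemma kOmega_central z u : subalg_gen [set omega] z -> GRing.comm z u.
Proof.
move=> /kOmegaP[p ->]; move: u.
apply: (gen (B := [set u | GRing.comm (horner_alg omega p) u])).
- split=> [|a u v hu hv|u v hu hv] /=; first exact: commr1.
    apply: commrD => //=.
    by rewrite /GRing.comm -scalerAr hu scalerAl.
  exact: commrM.
- by apply: coef_alg_comm => //; apply: coef_alg_ev0.
- by apply: coef_alg_comm => //; apply: coef_alg_ev0.
- by apply: coef_alg_comm => //; apply: coef_alg_ev0.
- have := delta_ev0M p 1; rewrite mulr1 delta1 mulr0 /delta => /subr0_eq.
  by move=> h; rewrite /= /GRing.comm -h.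
Qed.

Lemma delta_ratioM h s c :
  h \in coef_alg -> s \in coef_alg -> c \in coef_alg ->
  delta s * c = s * delta c -> delta (h * s) * (h * c) = h * s * delta (h * c).
Proof.
move=> hh hs hc e.
have hd u : u \in coef_alg -> delta u \in coef_alg := @coef_alg_delta u.
have C := coef_alg_comm.
rewrite !deltaM [LHS]mulrDl [RHS]mulrDr; congr (_ + _).
  rewrite -[RHS]mulrA -[LHS]mulrA [s * (h * c)]mulrA (C s h) // -[h * s * c]mulrA.
  rewrite mulrA (C _ h) ?hd // -mulrA; congr (_ * _).
  by rewrite mulrA (C _ s) ?hd // -mulrA.
rewrite -[LHS]mulrA -[RHS]mulrA; congr (_ * _).
by rewrite mulrA (C _ h) ?hd // -mulrA e mulrA (C h) // -mulrA.
Qed.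

(** The equation says that [c / s] is a constant. Multiplying [c] and [s] by
    the conjugate of [s] and by a power of [g] makes the denominator a
    polynomial in [g] over [k[Omega]] without changing the fraction. *)
Lemma constants_fraction s c : s \in coef_alg -> c \in coef_alg -> s != 0 ->
    delta s * c = s * delta c ->
  exists p q, [/\ subalg_gen [set omega] p, subalg_gen [set omega] q, p != 0
    & p * c = q * s].
Proof.
move=> hs hc s0 e.
have ggN N : g ^+ N * gi ^+ N = 1.
  by rewrite -exprMn_comm ?ggi ?expr1n // /GRing.comm ggi gig.
have [N [a [b es]]] := coef_alg_normal hs.
have ab0 : nf a b != 0 by apply: contra_neq s0; rewrite es => ->; rewrite mulr0.
have [t t0 et] := nf_norm ab0.
pose h1 := nf a (- b) * g ^+ N.
have hh1 : h1 \in coef_alg by rewrite rpredM ?rpredX ?coef_alg_nf.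
have h1s : h1 * s = ev t by rewrite es /h1 mulrA -(mulrA (nf _ _)) ggN mulr1.
have [M [d [f ec]]] := coef_alg_normal (rpredM hh1 hc).
pose h := g ^+ M * h1.
have hh : h \in coef_alg by rewrite rpredM ?rpredX.
pose S := 'X ^+ M * t.
have hsE : h * s = ev S by rewrite /h -mulrA h1s rmorphM rmorphXn /= evX.
have hcE : h * c = nf d f by rewrite /h -mulrA ec mulrA ggN mul1r.
clearbody h; have S0 : S != 0 by rewrite mulf_neq0 // expf_neq0 // polyX_eq0.
have : delta (ev S) * nf d f = ev S * delta (nf d f).
  by rewrite -hsE -hcE; apply: delta_ratioM.
move=> /(constants_ratio S0)[f0 eS].
exists (horner_alg omega (lead_coef S)), (horner_alg omega d`_(size S).-1).
split; [by apply/kOmegaP; eexists | by apply/kOmegaP; eexists | |].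
  apply: contra_neq S0 => L0; apply/eqP; rewrite -lead_coef_eq0.
  have := @nf_eq0 (lead_coef S)%:P 0.
  rewrite /nf rmorph0 mul0r addr0 evC L0 => /(_ erefl)[/eqP].
  by rewrite polyC_eq0.
have h0 : h != 0.
  apply: contra_neq S0 => h0; have := @nf_eq0 S 0.
  by rewrite /nf rmorph0 mul0r addr0 -hsE h0 mul0r => /(_ erefl)[].
apply: subr0_eq; apply: coef_alg_domain h0 _ => //.
  by rewrite rpredB ?rpredM ?coef_alg_ev0.
rewrite mulrBr !mulrA ![h * horner_alg _ _]coef_alg_comm ?coef_alg_ev0 //.
rewrite -!mulrA hsE hcE f0 /nf rmorph0 mul0r addr0 -!evC -!rmorphM.
by rewrite !mul_polyC eS subrr.
Qed.

(** Here the denominator is a power of [g], whose leading coefficient is [1], so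
    no fraction of [k[Omega]] appears. *)
Lemma center_kOmega z : z * g = g * z -> z * y = y * z -> subalg_gen [set omega] z.
Proof.
move=> zg zy; have hz := centralizer_g zg.
have dz : delta z = 0 by rewrite /delta zy subrr.
have [N [a [b ez]]] := coef_alg_normal hz.
have ggN : g ^+ N * gi ^+ N = 1.
  by rewrite -exprMn_comm ?ggi ?expr1n // /GRing.comm ggi gig.
have XN0 : ('X ^+ N : {poly {poly k}}) != 0 by rewrite expf_neq0 // polyX_eq0.
have evXN : ev 'X^N = g ^+ N by rewrite rmorphXn /= evX.
have ab : nf a b = g ^+ N * z by rewrite ez mulrA ggN mul1r.
have hgN : g ^+ N \in coef_alg by rewrite rpredX.
have : delta (ev 'X^N) * nf a b = ev 'X^N * delta (nf a b).
  rewrite evXN ab deltaM dz mulr0 addr0.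
  by rewrite mulrA (coef_alg_comm (coef_alg_delta hgN) hgN) mulrA.
move=> /(constants_ratio XN0)[b0]; rewrite lead_coefXn scale1r size_polyXn => ea.
apply/kOmegaP; exists a`_N.
suff : g ^+ N * z = g ^+ N * horner_alg omega a`_N.
  move/(congr1 ( *%R (gi ^+ N))); rewrite !mulrA -exprMn_comm.
    by rewrite gig expr1n !mul1r.
  by rewrite /GRing.comm ggi gig.
rewrite -ab b0 /nf rmorph0 mul0r addr0 [in LHS]ea -mul_polyC rmorphM /= evC evXN.
by apply: coef_alg_comm => //; apply: coef_alg_ev0.
Qed.

Lemma center_eq : ring_center A = subalg_gen [set omega].
Proof.
apply/seteqP; split=> z; first by move=> hz; apply: center_kOmega; exact: hz.
by move=> hz u; exact: kOmega_central.
Qed.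

(** * The localization *)

Section Localization.
Variables (L : nzRingType) (iota : {rmorphism A -> L}).
Hypothesis loc : ore_localization (subalg_gen [set` [:: g; gi; x]] `\ 0) iota.

Lemma coef_alg_inverse s : s \in coef_alg -> s != 0 ->
  exists t, is_inverse (iota s) t.
Proof.
case: loc => inv _ _ /subalg_predP hs /eqP s0.
by apply: inv; split.
Qed.

Lemma iota_eq0 u : iota u = 0 -> u = 0.
Proof.
case: loc => _ _ ker /ker[s [/subalg_predP hs /= s0] su].
have [P /[dup] hP /polyOverP hPi eu] := y_span u.
suff P0 : P = 0 by rewrite eu P0 horner0.
apply/polyP => i; rewrite coef0.
have /polyP/(_ i) : s%:P * P = 0.
  apply: y_free; first by rewrite rpredM ?polyOverC.
  by rewrite hornerCM -eu.
rewrite coefCM coef0; apply: coef_alg_domain => //; exact/eqP.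
Qed.

Lemma iota_inj : injective iota.
Proof. by move=> u v e; apply/subr0_eq/iota_eq0; rewrite rmorphB e subrr. Qed.

Lemma comm_inverse (R : nzRingType) (z s t : R) :
  is_inverse s t -> GRing.comm z s -> GRing.comm z t.
Proof.
move=> [st ts] zs; rewrite /GRing.comm -[LHS]mul1r -ts -mulrA (mulrA s) -zs.
by rewrite -mulrA st mulr1.
Qed.

(** An element commuting with the image of [A] commutes with the inverses of
    the denominators, hence with all fractions. *)
Lemma comm_iota_center z : (forall u, GRing.comm z (iota u)) -> ring_center L z.
Proof.
case: loc => _ frac _ hz w; have [s [u [t [_ st ->]]]] := frac w.
by apply: commrM; [exact: comm_inverse st (hz s) | exact: hz].
Qed.

(** A central fraction [z = s^-1 u] can be studied without leaving [A]: since
    [z] commutes with [g], so does [u = s z], which forces [u] into the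
    commutative subalgebra; since [z] commutes with [y], [delta u = delta s z],
    i.e. [delta s * u = s * delta u]. *)
Lemma center_localization :
  ring_center L = fractions_in iota (subalg_gen [set omega]).
Proof.
apply/seteqP; split=> [z hz|_ [a [b [t [ha hb b0 bt ->]]]]]; last first.
  have cen u c : subalg_gen [set omega] c -> GRing.comm (iota c) (iota u).
    by move=> hc; rewrite /GRing.comm -!rmorphM kOmega_central.
  apply: comm_iota_center => u; apply: commr_sym; apply: commrM.
    by apply: commr_sym; exact: cen.
  by apply: comm_inverse bt _; apply: commr_sym; exact: cen.
case: (loc) => _ frac _; have [s [u [t [[/subalg_predP hs /= s0] st ez]]]] := frac z.
have sz : iota s * z = iota u by rewrite ez mulrA (st.1) mul1r.
have comm_sz v : iota (v * u) = iota v * iota s * z by rewrite rmorphM -mulrA sz.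
have hu : u \in coef_alg.
  apply: centralizer_g; apply: iota_inj; rewrite rmorphM comm_sz -sz.
  by rewrite -rmorphM (coef_alg_comm coef_alg_g hs) rmorphM -!mulrA [z * _]hz.
have du : delta s * u = s * delta u.
  have ds : iota (delta u) = iota (delta s) * z.
    rewrite /delta !rmorphB !rmorphM -sz mulrBl -!mulrA; congr (_ - _).
    by rewrite [z * _]hz.
  apply: iota_inj; rewrite !rmorphM ds -sz !mulrA -!rmorphM.
  by rewrite coef_alg_comm // coef_alg_delta.
have [p [q [hp hq p0 e]]] := constants_fraction hs hu (introN eqP s0) du.
have [t' pt'] := coef_alg_inverse (kOmega_coef_alg hp) p0.
exists q, p, t'; split=> //.
have zp : iota p * z = iota q.
  have : iota s * (iota p * z) = iota s * iota q.
    rewrite mulrA -rmorphM -(kOmega_central s hp) rmorphM -mulrA sz -rmorphM e.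
    by rewrite -rmorphM (kOmega_central s hq).
  by move/(congr1 ( *%R t)); rewrite !mulrA st.2 !mul1r.
by rewrite -zp -hz -mulrA pt'.1 mulr1.
Qed.

End Localization.
End OreAlgebra.

(** * The center of U and of its localization *)

Theorem lemma4p1 (k : closedFieldType) (char0 : [pchar k] =i pred0)
    (lam : k) (lam_neq0 : lam != 0)
    (US : algType k) (iota : {lrmorphism U lam -> US})
    (locUS : ore_localization (Sset lam) iota) :
  ring_center US = fractions_in iota (kOmega lam) /\
  ring_center (U lam) = kOmega lam.
Proof.
have hchar n : ((n%:R : k) == 0) = (n == 0)%N by move/pcharf0P: char0.
have [coords [[coords_lin coords1] coords_g coords_gi coords_x coords_y]] :=
  U_coordinates lam (two_neq0 hchar).
split.
  exact: (center_localization hchar (U_relations lam) coords_lin coords1 coords_g coords_gi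
    coords_x coords_y (@U_gen_ind k lam) locUS).
exact: (center_eq hchar (U_relations lam) coords_lin coords1 coords_g coords_gi
  coords_x coords_y (@U_gen_ind k lam)).
Qed.
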